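(* Let $p_1$ and $p_4$ be odd, let $p_2$ be an even divisor of $2p_1$, and let $p_3$ be an even divisor of $2p_4$. Then $\mathcal{P}(p_1,p_2,p_3,p_4)$ is a tight orientably-regular polytope of type $\{p_1,p_2,p_3,p_4\}$.
   Context: For such a tuple, $\Gamma(p_1,p_2,p_3,p_4)$ is the group generated by $x_0,\ldots,x_4$ subject to $x_j^2=1$, $(x_{j-1}x_j)^{p_j}=1$ ($1\le j\le 4$), $(x_jx_k)^2=1$ for $|j-k|\ge 2$, $(x_0x_1x_2x_1x_2)^2=1$, $(x_1x_2x_3x_2)^2=1$ and $(x_4x_3x_2x_3x_2)^2=1$. $\mathcal{P}(p_1,\ldots,p_4)$ is the poset built from $\Gamma=\Gamma(p_1,\ldots,p_4)$: for $0\le j\le 4$ its $j$-faces are the right cosets of $\Gamma_j=\langle x_k:k\ne j\rangle$, with $\Gamma_j\varphi\le\Gamma_k\psi$ iff $j\le k$ and the cosets intersect, together with a least face of rank $-1$ and a greatest face of rank $5$. An abstract polytope of rank $5$ is a ranked poset (ranks $-1$ to $5$) with unique least and greatest faces, flags of $7$ faces, connected sections and the diamond condition; it has type $\{p_1,\ldots,p_4\}$ if for each $j$ every section between an $(j-2)$-face and an incident $(j+1)$-face is a $p_j$-gon; it is tight if it has exactly $2p_1p_2p_3p_4$ flags; it is regular if its automorphism group is flag-transitive (generated by reflections $\rho_0,\ldots,\rho_4$ relative to a base flag), and orientably-regular if the rotation subgroup $\langle\rho_{j-1}\rho_j\rangle$ has index $2$. *)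

(* Defs.v *)
From HB Require Import structures.
From mathcomp Require Import all_boot all_order all_algebra.
From mathcomp Require Import mathcomp_extra boolp classical_sets functions cardinality.

Set Implicit Arguments.
Unset Strict Implicit.
Unset Printing Implicit Defensive.

Import Order.TTheory.

Local Open Scope classical_set_scope.
Local Open Scope card_scope.
Local Open Scope order_scope.

Section Subgroups.
Local Open Scope group_scope.
Variable G : groupType.
Implicit Types (A H : set G) (g h : G).

Definition subgroup H :=
  [/\ H 1, forall g h, H g -> H h -> H (g * h) & forall g, H g -> H g^-1].

Definition generated A : set G := smallest subgroup A.

Definition rcoset H g : set G := [set h * g | h in H].

Lemma generated_ind A H g : subgroup H -> A `<=` H -> generated A g -> H g.
Proof. by move=> sgH AH Ag; apply: Ag. Qed.

Lemma sub_generated A : A `<=` generated A.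
Proof. exact: sub_smallest. Qed.

Lemma generated_subgroup A : subgroup (generated A).
Proof.
split=> [H [[]]|g h Ag Ah H HA|g Ag H HA] //.
- by case: (HA) => -[_ HM _] _; apply: HM; [apply: Ag | apply: Ah].
- by case: (HA) => -[_ _ HV] _; apply: HV; apply: Ag.
Qed.

Lemma generatedS A B : A `<=` B -> generated A `<=` generated B.
Proof.
move=> AB g; apply: generated_ind; first exact: generated_subgroup.
exact: subset_trans AB (@sub_generated B).
Qed.

Lemma rcoset_refl H g : subgroup H -> rcoset H g g.
Proof. by case=> H1 _ _; exists 1 => //; rewrite mul1g. Qed.

Lemma rcosetP H g h : rcoset H g h <-> H (h * g^-1).
Proof.
split=> [[k Hk <-]|Hhg]; first by rewrite mulgK.
by exists (h * g^-1) => //; rewrite mulgVK.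
Qed.

Lemma rcoset_eq H g h : subgroup H -> rcoset H g h -> rcoset H g = rcoset H h.
Proof.
move=> [_ HM HV] /rcosetP Hhg; apply/seteqP; split=> k /rcosetP Hk; apply/rcosetP.
  have -> : k * h^-1 = (k * g^-1) * (h * g^-1)^-1.
    by rewrite invgM invgK mulgA mulgVK.
  by apply: HM => //; apply: HV.
have -> : k * g^-1 = (k * h^-1) * (h * g^-1) by rewrite mulgA mulgVK.
exact: HM.
Qed.

Lemma centraliser_subgroup A :
  subgroup [set g | forall h, A h -> g * h = h * g].
Proof.
split=> [h _|g1 g2 c1 c2 h Ah|g c h Ah] /=; first by rewrite mulg1 mul1g.
  by rewrite -mulgA (c2 h Ah) mulgA (c1 h Ah) -mulgA.
by apply/esym/commuteV/esym/c.
Qed.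

Lemma generated_commute A B :
    (forall g h, A g -> B h -> g * h = h * g) ->
  forall g h, generated A g -> generated B h -> g * h = h * g.
Proof.
move=> AB g h Ag Bh.
have /generated_ind : A `<=` [set g | forall h, generated B h -> g * h = h * g].
  move=> {Ag} g Ag {Bh} h Bh; apply/esym.
  apply: (generated_ind (centraliser_subgroup [set g]) _ Bh) => // {Bh} h Bh _ ->.
  exact/esym/AB.
by move=> /(_ g (centraliser_subgroup _) Ag); apply.
Qed.

End Subgroups.

(** The letter [(i, true)] stands for the generator [i], and [(i, false)] for
    its inverse. *)
Definition word (I : Type) := seq (I * bool).

Definition word_inv (I : Type) (u : word I) : word I :=
  rev [seq (a.1, ~~ a.2) | a <- u].

Inductive word_eq (I : Type) (R : set (word I)) : word I -> word I -> Prop :=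
| word_eq_refl u : word_eq R u u
| word_eq_sym u v : word_eq R u v -> word_eq R v u
| word_eq_trans u v w : word_eq R u v -> word_eq R v w -> word_eq R u w
| word_eq_cat u u' v v' :
    word_eq R u u' -> word_eq R v v' -> word_eq R (u ++ v) (u' ++ v')
| word_eq_cancel i b : word_eq R [:: (i, b); (i, ~~ b)] [::]
| word_eq_relator r : R r -> word_eq R r [::].

Lemma word_inv_inv (I : Type) : involutive (@word_inv I).
Proof.
move=> u; rewrite /word_inv map_rev revK.
by elim: u => [|[i b] u IH] //=; rewrite negbK IH.
Qed.

Section Presentation.
Variables (I : choiceType) (R : set (word I)).
Implicit Types u v w : word I.

Definition word_eqb u v : bool := `[< word_eq R u v >].

Lemma word_eqb_refl : reflexive word_eqb.
Proof. by move=> u; apply/asboolP; apply: word_eq_refl. Qed.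

Lemma word_eqb_sym : symmetric word_eqb.
Proof. by move=> u v; apply/asboolP/asboolP => /word_eq_sym. Qed.

Lemma word_eqb_trans : transitive word_eqb.
Proof.
move=> v u w /asboolP uv /asboolP vw; apply/asboolP; exact: word_eq_trans vw.
Qed.

Canonical word_equiv := EquivRel word_eqb word_eqb_refl word_eqb_sym word_eqb_trans.

Local Open Scope quotient_scope.

Definition presented := {eq_quot word_eqb}.
HB.instance Definition _ := Choice.on presented.
HB.instance Definition _ := EqQuotient.on presented.

Lemma presented_eqP u v : reflect (word_eq R u v) (\pi_presented u == \pi_presented v).
Proof. by rewrite piE; apply: asboolP. Qed.

Lemma word_eq_catinv u : word_eq R (u ++ word_inv u) [::].
Proof.
elim: u => [|[i b] u IH]; first exact: word_eq_refl.
rewrite /word_inv /= rev_cons -cats1 catA -(cat1s (i, b) (_ ++ _)) /=.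
apply: (word_eq_trans _ (word_eq_cancel R i b)).
rewrite -(cat1s (i, b) [:: _]) -(cat1s (i, b) (_ ++ [:: _])).
apply: word_eq_cat; first exact: word_eq_refl.
rewrite -{2}(cat0s [:: (i, ~~ b)]).
by apply: word_eq_cat; [exact: IH | exact: word_eq_refl].
Qed.

Lemma word_eq_invcat u : word_eq R (word_inv u ++ u) [::].
Proof. by have := word_eq_catinv (word_inv u); rewrite word_inv_inv. Qed.

Lemma word_inv_cat u v : word_inv (u ++ v) = word_inv v ++ word_inv u.
Proof. by rewrite /word_inv map_cat rev_cat. Qed.

Lemma word_eq_inv u v : word_eq R u v -> word_eq R (word_inv u) (word_inv v).
Proof.
move=> uv.
have h1 : word_eq R (word_inv u ++ (v ++ word_inv v)) (word_inv u).
  rewrite -{2}[word_inv u]cats0; apply: word_eq_cat; first exact: word_eq_refl.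
  exact: word_eq_catinv.
have h2 : word_eq R ((word_inv u ++ v) ++ word_inv v) (word_inv v).
  rewrite -{2}[word_inv v]cat0s; apply: word_eq_cat; last exact: word_eq_refl.
  apply: word_eq_trans (word_eq_invcat u); apply: word_eq_cat.
    exact: word_eq_refl.
  exact: word_eq_sym.
by apply: word_eq_trans (word_eq_sym h1) _; rewrite catA.
Qed.

Definition presented_one : presented := \pi_presented [::].
Definition presented_inv (g : presented) : presented := \pi_presented (word_inv (repr g)).
Definition presented_mul (g h : presented) : presented := \pi_presented (repr g ++ repr h).

Lemma presented_repr u : word_eq R (repr (\pi_presented u)) u.
Proof. by apply/presented_eqP; rewrite reprK. Qed.

Lemma presented_mulE u v :
  presented_mul (\pi_presented u) (\pi_presented v) = \pi_presented (u ++ v).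
Proof. by apply/eqP/presented_eqP; apply: word_eq_cat; apply: presented_repr. Qed.

Lemma presented_invE u : presented_inv (\pi_presented u) = \pi_presented (word_inv u).
Proof. by apply/eqP/presented_eqP; apply: word_eq_inv; apply: presented_repr. Qed.

Lemma presented_mulA : associative presented_mul.
Proof.
move=> g h k; rewrite -[g]reprK -[h]reprK -[k]reprK.
rewrite (presented_mulE (repr h)) (presented_mulE (repr g) (repr h)).
by rewrite (presented_mulE (repr g)) (presented_mulE (_ ++ _)) catA.
Qed.

Lemma presented_1mul : left_id presented_one presented_mul.
Proof. by move=> g; rewrite -[g]reprK presented_mulE. Qed.

Lemma presented_mul1 : right_id presented_one presented_mul.
Proof. by move=> g; rewrite -[g]reprK presented_mulE cats0. Qed.

Lemma presented_Vmul : left_inverse presented_one presented_inv presented_mul.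
Proof.
move=> g; rewrite -[g]reprK presented_invE presented_mulE.
by apply/eqP/presented_eqP; apply: word_eq_invcat.
Qed.

Lemma presented_mulV : right_inverse presented_one presented_inv presented_mul.
Proof.
move=> g; rewrite -[g]reprK presented_invE presented_mulE.
by apply/eqP/presented_eqP; apply: word_eq_catinv.
Qed.

HB.instance Definition _ := isGroup.Build presented
  presented_mulA presented_1mul presented_mul1 presented_Vmul presented_mulV.

Lemma presented_piM u v :
  (\pi_presented u * \pi_presented v)%g = \pi_presented (u ++ v).
Proof. exact: presented_mulE. Qed.

Lemma presented_relator r : R r -> \pi_presented r = 1%g.
Proof. by move=> Rr; apply/eqP/presented_eqP/word_eq_relator. Qed.

Definition presented_gen (i : I) : presented := \pi_presented [:: (i, true)].

End Presentation.

Section Polytopes.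
Context {d : Order.disp_t} {T : tbPOrderType d}.
Implicit Types (C : set T) (F G H K : T).

Definition chain C := total_on C (fun F G => F <= G).

Definition flag C := chain C /\ forall D, chain D -> C `<=` D -> D = C.

Definition proper_section F G : set T := [set H | F < H < G].

Definition connected_section F G :=
  forall H K, proper_section F G H -> proper_section F G K ->
  exists s : seq T, [/\ path (fun X Y => X >=< Y) H s, last H s = K
                      & forall X, X \in s -> proper_section F G X].

(** The section [G / F] has rank [rk G - rk F - 1]; sections of rank at most 1
    are connected by convention. *)
Record is_polytope (n : nat) (rk : T -> int) : Prop := IsPolytope {
  rank_bottom : rk \bot = (-1)%R ;
  rank_top : rk \top = n%:Z%R ;
  rank_lt : forall F G, F < G -> (rk F < rk G)%R ;
  card_flag : forall C, flag C -> C #= `I_n.+2 ;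
  sections_connected : forall F G, F < G -> (2 <= rk G - rk F - 1)%R ->
    connected_section F G ;
  diamond : forall F G, F < G -> (rk G = rk F + 2)%R ->
    proper_section F G #= `I_2 }.

(** [v] and [e] list the vertices and the edges of the section in cyclic order,
    so that the edge [e i] joins [v i] to the next vertex; this also covers
    the digon [p = 2]. *)
Definition polygon_section (rk : T -> int) (p : nat) F G :=
  exists v e : 'I_p -> T,
    [/\ injective v, injective e,
        range v = [set H | proper_section F G H /\ rk H = (rk F + 1)%R],
        range e = [set H | proper_section F G H /\ rk H = (rk F + 2)%R]
      & forall i j, (v i <= e j) = (i == j) || (i == ordS j)].

(** [nth 0 ps j.-1] is [p_j] in [{p_1, ..., p_(n-1)}]. *)
Definition has_type (rk : T -> int) (ps : seq nat) :=
  forall j : nat, (1 <= j <= size ps)%N ->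
  forall F G, rk F = (j%:Z - 2)%R -> rk G = (j%:Z + 1)%R -> F < G ->
  polygon_section rk (nth 0%N ps j.-1) F G.

Definition tight (ps : seq nat) :=
  [set C | flag C] #= `I_(2 * \prod_(p <- ps) p)%N.

End Polytopes.

Arguments tight {d} T ps.

Section Automorphisms.
Context {d : Order.disp_t} (T : tbPOrderType d).

Record automorphism := Automorphism {
  aut_fun :> T -> T ;
  aut_inv : T -> T ;
  aut_funK : cancel aut_fun aut_inv ;
  aut_invK : cancel aut_inv aut_fun ;
  aut_mono : {mono aut_fun : F G / F <= G} }.

Lemma aut_ext (f g : automorphism) : f =1 g -> f = g.
Proof.
case: f g => [f f' fK f'K fm] [g g' gK g'K gm] /= fg.
have {}fg : f = g by apply: funext.
case: g / fg gK g'K gm => gK g'K gm.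
have fg' : f' = g' by apply: funext => x; rewrite -{1}(g'K x) fK.
by case: g' / fg' gK g'K => gK g'K; congr Automorphism; apply: Prop_irrelevance.
Qed.

HB.instance Definition _ := gen_eqMixin automorphism.
HB.instance Definition _ := gen_choiceMixin automorphism.

Definition aut_one : automorphism :=
  @Automorphism id id (fun=> erefl) (fun=> erefl) (fun _ _ => erefl).

Lemma aut_invf_mono (f : automorphism) : {mono aut_inv f : F G / F <= G}.
Proof. by move=> F G; rewrite -(aut_mono f) !aut_invK. Qed.

Definition aut_invg (f : automorphism) : automorphism :=
  Automorphism (aut_invK f) (aut_funK f) (aut_invf_mono f).

Lemma aut_comp_mono (f g : automorphism) : {mono g \o f : F G / F <= G}.
Proof. by move=> F G /=; rewrite !aut_mono. Qed.

(** As in [perm], [f * g] applies [f] first. *)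
Definition aut_mul (f g : automorphism) : automorphism :=
  Automorphism (can_comp (aut_funK g) (aut_funK f))
    (can_comp (aut_invK f) (aut_invK g)) (aut_comp_mono f g).

Lemma aut_mulA : associative aut_mul.
Proof. by move=> f g h; apply: aut_ext. Qed.

Lemma aut_1mul : left_id aut_one aut_mul.
Proof. by move=> f; apply: aut_ext. Qed.

Lemma aut_mul1 : right_id aut_one aut_mul.
Proof. by move=> f; apply: aut_ext. Qed.

Lemma aut_Vmul : left_inverse aut_one aut_invg aut_mul.
Proof. by move=> f; apply: aut_ext => x /=; rewrite aut_invK. Qed.

Lemma aut_mulV : right_inverse aut_one aut_invg aut_mul.
Proof. by move=> f; apply: aut_ext => x /=; rewrite aut_funK. Qed.

HB.instance Definition _ := isGroup.Build automorphism
  aut_mulA aut_1mul aut_mul1 aut_Vmul aut_mulV.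

End Automorphisms.

Section Regularity.
Context {d : Order.disp_t} {T : tbPOrderType d}.
Variables (n : nat) (rk : T -> int).
Local Open Scope group_scope.

Definition flag_transitive :=
  forall C D : set T, flag C -> flag D -> exists f : automorphism T, f @` C = D.

(** [rho i] sends the base flag [C] to the flag differing from it exactly in
    its [i]-face. *)
Definition base_reflections (C : set T) (rho : 'I_n -> automorphism T) :=
  forall (i : 'I_n) (F : T), C F -> (rho i F == F) = (rk F != i%:Z%R).

Definition rotation_subgroup (rho : 'I_n -> automorphism T) :
    set (automorphism T) :=
  generated [set s | exists i j : 'I_n, j = i.+1 :> nat /\ s = rho i * rho j].

Definition orientably_regular :=
  flag_transitive /\
  exists (C : set T) (rho : 'I_n -> automorphism T),
    [/\ flag C, base_reflections C rho, generated (range rho) = setT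
      & range (rcoset (rotation_subgroup rho)) #= `I_2].

End Regularity.

(** The word [(x_i1 ... x_ir)^k], for the letters [s = [:: i1; ...; ir]]. *)
Definition word_pow (s : seq nat) (k : nat) : word 'I_5 :=
  flatten (nseq k [seq (inord i, true) | i <- s]).

Inductive Gamma_relators (p1 p2 p3 p4 : nat) : set (word 'I_5) :=
| rel_involution (j : 'I_5) : Gamma_relators p1 p2 p3 p4 (word_pow [:: j : nat] 2)
| rel_p1 : Gamma_relators p1 p2 p3 p4 (word_pow [:: 0; 1] p1)
| rel_p2 : Gamma_relators p1 p2 p3 p4 (word_pow [:: 1; 2] p2)
| rel_p3 : Gamma_relators p1 p2 p3 p4 (word_pow [:: 2; 3] p3)
| rel_p4 : Gamma_relators p1 p2 p3 p4 (word_pow [:: 3; 4] p4)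
| rel_commute (j k : 'I_5) : (j.+1 < k)%N || (k.+1 < j)%N ->
    Gamma_relators p1 p2 p3 p4 (word_pow [:: j : nat; k : nat] 2)
| rel_01212 : Gamma_relators p1 p2 p3 p4 (word_pow [:: 0; 1; 2; 1; 2] 2)
| rel_1232 : Gamma_relators p1 p2 p3 p4 (word_pow [:: 1; 2; 3; 2] 2)
| rel_43232 : Gamma_relators p1 p2 p3 p4 (word_pow [:: 4; 3; 2; 3; 2] 2).

Section GammaPoset.
Variables p1 p2 p3 p4 : nat.

Definition Gamma : groupType := presented (Gamma_relators p1 p2 p3 p4).

Definition Gamma_gen (j : 'I_5) : Gamma :=
  presented_gen (Gamma_relators p1 p2 p3 p4) j.

Definition Gamma_sub (j : 'I_5) : set Gamma :=
  generated (Gamma_gen @` [set k | k != j]).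

Definition Gamma_coset (j : 'I_5) (A : set Gamma) :=
  exists g : Gamma, A = rcoset (Gamma_sub j) g.

Inductive Gamma_poset : Type :=
| LeastFace
| CosetFace (j : 'I_5) (A : set Gamma) of Gamma_coset j A
| GreatestFace.

Definition Gamma_rank (F : Gamma_poset) : int :=
  match F with
  | LeastFace => (-1)%R
  | CosetFace j _ _ => j%:Z%R
  | GreatestFace => 5%R
  end.

Definition Gamma_le (F G : Gamma_poset) : bool :=
  match F, G with
  | LeastFace, _ | _, GreatestFace => true
  | CosetFace j A _, CosetFace k B _ => (j <= k)%N && `[< A `&` B !=set0 >]
  | _, _ => false
  end.

Local Open Scope group_scope.

Lemma Gamma_gen_invol (j : 'I_5) : Gamma_gen j * Gamma_gen j = 1.
Proof.
have := presented_relator (rel_involution p1 p2 p3 p4 j).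
by rewrite /word_pow /= inord_val => <-; apply: presented_piM.
Qed.

Lemma Gamma_gen_inv (j : 'I_5) : (Gamma_gen j)^-1 = Gamma_gen j.
Proof. by apply: (mulgI (Gamma_gen j)); rewrite mulgV Gamma_gen_invol. Qed.

Lemma Gamma_gen_commute (j k : 'I_5) : (j.+1 < k)%N ->
  Gamma_gen j * Gamma_gen k = Gamma_gen k * Gamma_gen j.
Proof.
move=> jk; set a := Gamma_gen j; set b := Gamma_gen k.
have abab : (a * b) * (a * b) = 1.
  have jk' : (j.+1 < k)%N || (k.+1 < j)%N by rewrite jk.
  have := presented_relator (rel_commute p1 p2 p3 p4 jk').
  rewrite /word_pow /= !inord_val => <-.
  have -> : a * b = \pi_(presented _)%qT [:: (j, true); (k, true)].
    exact: presented_piM.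
  exact: presented_piM.
have /esym := mulg1_eq abab.
by rewrite invgM !Gamma_gen_inv.
Qed.

Lemma Gamma_sub_decomp (j : 'I_5) (g : Gamma) : Gamma_sub j g ->
  exists u v, [/\ generated (Gamma_gen @` [set k : 'I_5 | (k < j)%N]) u,
                  generated (Gamma_gen @` [set k : 'I_5 | (j < k)%N]) v & g = u * v].
Proof.
set U := generated _; set V := generated (Gamma_gen @` [set k : 'I_5 | (j < k)%N]).
have UV u v : U u -> V v -> u * v = v * u.
  apply: generated_commute => _ _ [k kj <-] [l jl <-].
  by apply: Gamma_gen_commute; apply: leq_ltn_trans kj jl.
have [U1 UM UI] : subgroup U by apply: generated_subgroup.
have [V1 VM VI] : subgroup V by apply: generated_subgroup.
pose W : set Gamma := [set g | exists u v, [/\ U u, V v & g = u * v]].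
apply: (@generated_ind _ _ W).
  split=> [|_ _ [u [v [Uu Vv ->]]] [u' [v' [Uu' Vv' ->]]]|_ [u [v [Uu Vv ->]]]].
  - by exists 1, 1; rewrite mulg1.
  - exists (u * u'), (v * v'); split; [exact: UM|exact: VM|].
    by rewrite -!mulgA; congr (_ * _); rewrite !mulgA (UV u' v).
  - exists u^-1, v^-1; split; [exact: UI|exact: VI|].
    by rewrite invgM (UV u^-1 v^-1) //; [exact: UI | exact: VI].
move=> _ [k /= kj <-]; have := kj.
rewrite -(inj_eq val_inj) neq_ltn => /orP[lkj|ljk].
  exists (Gamma_gen k), 1; rewrite mulg1; split=> //.
  by apply: sub_generated; exists k.
exists 1, (Gamma_gen k); rewrite mul1g; split=> //.
by apply: sub_generated; exists k.
Qed.

Local Close Scope group_scope.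

HB.instance Definition _ := gen_eqMixin Gamma_poset.
HB.instance Definition _ := gen_choiceMixin Gamma_poset.

Lemma Gamma_sub_subgroup (j : 'I_5) : subgroup (Gamma_sub j).
Proof. exact: generated_subgroup. Qed.

Lemma Gamma_coset_eq (j : 'I_5) (A : set Gamma) (g : Gamma) :
  Gamma_coset j A -> A g -> A = rcoset (Gamma_sub j) g.
Proof. by move=> [h ->]; apply: rcoset_eq; apply: Gamma_sub_subgroup. Qed.

Lemma Gamma_le_refl : reflexive Gamma_le.
Proof.
case=> //= j A [g ->]; rewrite leqnn; apply/asboolP; exists g.
by split; apply: rcoset_refl; apply: Gamma_sub_subgroup.
Qed.

Lemma Gamma_le_anti : antisymmetric Gamma_le.
Proof.
move=> [|j A cA|] [|k B cB|] //= /andP[/andP[jk /asboolP[g [Ag Bg]]] /andP[kj _]].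
have ejk : j = k by apply/val_inj/eqP; rewrite eqn_leq jk kj.
case: k / ejk {jk kj} cB => cB.
have AB : A = B by rewrite (Gamma_coset_eq cA Ag) (Gamma_coset_eq cB Bg).
by case: B / AB cB {Bg} => cB; congr CosetFace; apply: Prop_irrelevance.
Qed.

Lemma Gamma_le_trans : transitive Gamma_le.
Proof.
move=> [|j B cB|] [|i A cA|] [|k C cC|] //=.
move=> /andP[ij /asboolP[a [Aa Ba]]] /andP[jk /asboolP[b [Bb Cb]]].
rewrite (leq_trans ij jk); apply/asboolP.
move: Bb; rewrite (Gamma_coset_eq cB Ba) => /rcosetP /Gamma_sub_decomp.
move=> [u [v [Uu Vv ba]]].
exists (v * a)%g; split.
  rewrite (Gamma_coset_eq cA Aa); apply/rcosetP.
  rewrite mulgK; apply: generatedS Vv => _ [l /= jl <-].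
  by exists l => //=; rewrite -(inj_eq val_inj) neq_ltn (leq_ltn_trans ij jl) orbT.
rewrite (Gamma_coset_eq cC Cb); apply/rcosetP.
have -> : (v * a * b^-1)%g = (u^-1)%g.
  have -> : b = (u * v * a)%g by rewrite -ba mulgVK.
  by rewrite !invgM !mulgA mulgK mulgV mul1g.
have [_ _ VC] := Gamma_sub_subgroup k; apply: VC.
apply: generatedS Uu => _ [l /= lj <-].
by exists l => //=; rewrite -(inj_eq val_inj) neq_ltn (leq_trans lj jk).
Qed.

Fact Gamma_display : Order.disp_t. Proof. exact: Order.Disp tt tt. Qed.

HB.instance Definition _ := Order.Le_isPOrder.Build Gamma_display Gamma_poset
  Gamma_le_refl Gamma_le_anti Gamma_le_trans.

Lemma Gamma_le0 (F : Gamma_poset) : LeastFace <= F.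
Proof. by []. Qed.

Lemma Gamma_le1 (F : Gamma_poset) : F <= GreatestFace.
Proof. by case: F. Qed.

HB.instance Definition _ :=
  Order.hasBottom.Build Gamma_display Gamma_poset Gamma_le0.
HB.instance Definition _ :=
  Order.hasTop.Build Gamma_display Gamma_poset Gamma_le1.

End GammaPoset.

(* Main.v *)
(** Put [a = (x1 x2)^2] and [b = (x3 x2)^2].  The last three families of relations
    say that [<a, b>] is abelian and normal: [x0], [x1], [x2] invert [a] while [x3],
    [x4] centralise it, and symmetrically for [b].  Modulo [<a, b>] the generator
    [x2] is central, so every element has the form
      [a^u (x0 x1)^r x0^e . b^v (x4 x3)^s x4^d . x2^n]
    with [u], [r], [v], [s] read modulo [p2/2], [p1], [p3/2], [p4].  Right
    multiplication by the generators acts on these exponents by explicit formulas,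
    which respect all relators because [p2/2] divides [p1] and [p3/2] divides [p4];
    hence the normal form is unique and the group has order [2 p1 p2 p3 p4].  In
    these coordinates each maximal parabolic subgroup is cut out by a condition, and
    any set of these conditions defines exactly the parabolic subgroup generated by
    the remaining generators.  This intersection property makes the coset poset a
    regular polytope whose flags correspond to group elements; all relators having
    even length, it is orientably regular. *)

Require Import Defs.
From mathcomp Require Import all_boot all_order all_algebra.
From mathcomp Require Import zify.
From mathcomp Require Import mathcomp_extra boolp classical_sets functions cardinality.

Set Implicit Arguments.
Unset Strict Implicit.
Unset Printing Implicit Defensive.

Import Order.TTheory GRing.Theory.

Local Open Scope classical_set_scope.

(** * Coordinates *)

Section HalfState.
Variables q p : nat.
Local Open Scope ring_scope.

(* [(u, r, e)] stands for [a^u (x y)^r x^e], where [x] is the outer generator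
   ([x0] or [x4]), [y] the inner one ([x1] or [x3]) and [a = (y x2)^2]. *)
Definition hstate : Type := ('I_q.+1 * 'I_p.+1 * bool)%type.

(** The sign that [x^e] gives to an exponent: [(x y)^r x y = (x y)^(r+1)], while
    [(x y)^r y = (x y)^(r-1) x]. The exponent of [a] follows the same sign, since [x] inverts
    [a]. *)
Definition turn m (e : bool) (x : 'I_m.+1) : 'I_m.+1 := if e then x else - x.

Definition outer (h : hstate) : hstate := let: (u, r, e) := h in (u, r, ~~ e).

(* Right multiplication by [y]; [n] tells whether a factor [x2] stands in
   between, in which case [x2 y = y a x2] also changes the exponent of [a]. *)
Definition inner (n : bool) (h : hstate) : hstate :=
  let: (u, r, e) := h in (u + (if n then turn e Zp1 else 0), r + turn e Zp1, ~~ e).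

Lemma turnN m e (x : 'I_m.+1) : turn (~~ e) x = - turn e x.
Proof. by case: e => //=; rewrite /turn opprK. Qed.

Lemma turnMn m e (x : 'I_m.+1) k : turn e x *+ k = turn e (x *+ k).
Proof. by case: e => //=; rewrite /turn mulNrn. Qed.

Lemma turn0 m e : turn e 0 = 0 :> 'I_m.+1.
Proof. by case: e; rewrite /turn ?oppr0. Qed.

Lemma Zp1_mulrn m k : Zp1 *+ k = inZp k :> 'I_m.+1.
Proof. by rewrite Zp_mulrn; apply: val_inj; rewrite /= modnMml mul1n. Qed.

Lemma Zp1_mulrn_eq0 m k : (Zp1 *+ k == 0 :> 'I_m.+1) = (m.+1 %| k)%N.
Proof. by rewrite Zp1_mulrn -val_eqE. Qed.

Lemma outerK : involutive outer.
Proof. by case=> [[u r] e]; rewrite /= negbK. Qed.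

Lemma innerK n : involutive (inner n).
Proof.
case=> [[u r] e]; rewrite /= !turnN negbK addrK.
by case: n; rewrite ?addrK ?addr0.
Qed.

(** A round flips [e] twice, so all rounds contribute with the same sign; it is that of [~~ e]
    because [outer] acts first. *)
Lemma iter_outer_inner n k (u : 'I_q.+1) (r : 'I_p.+1) e :
  iter k (inner n \o outer) (u, r, e) =
  (u + (if n then turn (~~ e) Zp1 *+ k else 0), r + turn (~~ e) Zp1 *+ k, e).
Proof.
elim: k => [|k IH]; first by rewrite /= !mulr0n !addr0 if_same addr0.
rewrite iterS {}IH /= negbK !mulrSr !addrA; congr (_, _, _).
by case: n => //; rewrite ?addr0 ?addrA.
Qed.

Lemma iter_inner_outer n k (u : 'I_q.+1) (r : 'I_p.+1) e :
  iter k (outer \o inner n) (u, r, e) =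
  (u + (if n then turn e Zp1 *+ k else 0), r + turn e Zp1 *+ k, e).
Proof.
elim: k => [|k IH]; first by rewrite /= !mulr0n !addr0 if_same addr0.
rewrite iterS {}IH /= negbK !mulrSr !addrA; congr (_, _, _).
by case: n => //; rewrite ?addr0 ?addrA.
Qed.

End HalfState.

Arguments outer {q p}.
Arguments inner {q p}.

(** * Action of words on coordinates, and its invariance under the relators *)

Section State.
Variables q2 q3 p1 p4 : nat.
Local Open Scope ring_scope.

Definition state : Type := (hstate q2 p1 * hstate q3 p4 * bool)%type.

Definition step (j : nat) (t : state) : state :=
  let: (h, k, n) := t in
  match j with
  | 0 => (outer h, k, n)
  | 1 => (inner n h, k, n)
  | 2 => (h, k, ~~ n)
  | 3 => (h, inner n k, n)
  | _ => (h, outer k, n)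
  end.

Definition base : state := ((0, 0, false), (0, 0, false), false).

(* The generators being involutions, a letter and its inverse act alike. *)
Definition run (w : word 'I_5) (t : state) : state :=
  foldl (fun t a => step (val a.1) t) t w.

Lemma stepK j : involutive (step j).
Proof.
move=> [[h k] n]; case: j => [|[|[|[|j]]]] /=;
by rewrite ?outerK ?innerK ?negbK.
Qed.

Lemma step_commute (j k : 'I_5) t : (j.+1 < k)%N ->
  step j (step k t) = step k (step j t).
Proof.
case: t => [[h l] n]; case: j k => [[|[|[|[|[|j]]]]] ?] [[|[|[|[|[|k]]]]] ?] //=.
Qed.

Lemma run_cat u v t : run (u ++ v) t = run v (run u t).
Proof. by rewrite /run foldl_cat. Qed.

Lemma run_word_pow s k t : all (fun i => i < 5)%N s ->
  run (word_pow s k) t = iter k (fun t => foldl (fun t j => step j t) t s) t.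
Proof.
move=> s5; elim: k t => [|k IH] t; first by [].
rewrite iterSr -{}IH [LHS]run_cat -/(word_pow s k); congr (run _ _).
elim: s s5 t => [|i s IH] //= /andP[i5 s5] t.
by rewrite /run /= inordK //; apply: IH.
Qed.

Hypothesis q2_dvd : (q2.+1 %| p1.+1)%N.
Hypothesis q3_dvd : (q3.+1 %| p4.+1)%N.

Lemma iter_step01 k h l n :
  iter k (fun t : state => step 1 (step 0 t)) (h, l, n) =
  (iter k (inner n \o outer) h, l, n).
Proof. by elim: k => [|k IH] //=; rewrite IH. Qed.

Lemma iter_step34 k h l n :
  iter k (fun t : state => step 4 (step 3 t)) (h, l, n) =
  (h, iter k (outer \o inner n) l, n).
Proof. by elim: k => [|k IH] //=; rewrite IH. Qed.

Lemma iter_double (X : Type) (f : X -> X) k x :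
  iter (2 * k)%N f x = iter k (fun y => f (f y)) x.
Proof. by elim: k => [|k IH]; rewrite ?muln0 // mulnS !addSn /= IH. Qed.

(** A single [x1 x2] flips [e] and [n]; only its square, which is [a], restores both, so double
    rounds are counted. *)
Lemma iter_step12 k u r e l n :
  iter (2 * k)%N (fun t : state => step 2 (step 1 t)) (u, r, e, l, n) =
  (u + turn (e (+) ~~ n) Zp1 *+ k, r, e, l, n).
Proof.
rewrite iter_double; elim: k => [|k IH]; first by rewrite /= mulr0n addr0.
rewrite iterS {}IH /= mulrSr !negbK addrA.
by case: n; case: e; rewrite /turn /= ?addr0 ?opprK ?addrK ?subrK.
Qed.

(** Here [x2] acts first: a double round is [(x2 x3)^2], the inverse of [b], whence the sign
    opposite to that in [iter_step12]. *)
Lemma iter_step23 k h v s d n :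
  iter (2 * k)%N (fun t : state => step 3 (step 2 t)) (h, (v, s, d), n) =
  (h, (v + turn (d (+) n) Zp1 *+ k, s, d), n).
Proof.
rewrite iter_double; elim: k => [|k IH]; first by rewrite /= mulr0n addr0.
rewrite iterS {}IH /= mulrSr !negbK addrA.
by case: n; case: d; rewrite /turn /= ?addr0 ?opprK ?addrK ?subrK.
Qed.

Lemma run_relator r t :
  Gamma_relators p1.+1 (2 * q2.+1)%N (2 * q3.+1)%N p4.+1 r -> run r t = t.
Proof.
have Zp1_pp : forall m k, (m.+1 %| k)%N -> Zp1 *+ k = 0 :> 'I_m.+1.
  by move=> m k dv; apply/eqP; rewrite Zp1_mulrn_eq0.
case=> [j|||||j k jk|||].
- rewrite run_word_pow /= ?ltn_ord //=; exact: stepK.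
- rewrite run_word_pow //; case: t => [[[[u r'] e] l] n].
  (* While [n] holds, the [p1.+1] rounds also add [p1.+1] to the exponent of [a], which is read
     modulo [q2.+1]: this is where [q2_dvd] enters, and [q3_dvd] symmetrically for [rel_p4]. *)
  rewrite iter_step01 iter_outer_inner !turnMn !Zp1_pp // !turn0 !addr0.
  by case: n; rewrite addr0.
- rewrite run_word_pow //; case: t => [[[[u r'] e] l] n].
  by rewrite iter_step12 turnMn Zp1_pp // turn0 addr0.
- rewrite run_word_pow //; case: t => [[h [[v s] d]] n].
  by rewrite iter_step23 turnMn Zp1_pp // turn0 addr0.
- rewrite run_word_pow //; case: t => [[h [[v s] d]] n].
  rewrite iter_step34 iter_inner_outer !turnMn !Zp1_pp // !turn0 !addr0.
  by case: n; rewrite addr0.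
- rewrite run_word_pow /= ?ltn_ord //=.
  by case/orP: jk => jk; rewrite (step_commute _ jk) !stepK.
- rewrite run_word_pow //=; case: t => [[[[u r'] e] l] n] /=.
  by case: n; case: e; rewrite /turn /= ?addr0 ?opprK ?addrK ?subrK ?addrK ?subrK.
- rewrite run_word_pow //=; case: t => [[[[u r'] e] [[v s] d]] n] /=.
  by case: n; case: e; case: d; rewrite /turn /= ?addr0 ?opprK ?addrK ?subrK ?addrK ?subrK.
- rewrite run_word_pow //=; case: t => [[h [[v s] d]] n] /=.
  by case: n; case: d; rewrite /turn /= ?addr0 ?opprK ?addrK ?subrK ?addrK ?subrK.
Qed.

Lemma run_word_eq u v t :
  word_eq (Gamma_relators p1.+1 (2 * q2.+1)%N (2 * q3.+1)%N p4.+1) u v -> run u t = run v t.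
Proof.
move=> uv; elim: uv t => //= {u v} [u v w _ IHu _ IHv t|||].
- by rewrite IHu.
- by move=> u u' v v' _ IHu _ IHv t; rewrite !run_cat IHu IHv.
- by move=> i b t; rewrite /run /= stepK.
- by move=> r Rr t; rewrite run_relator.
Qed.

End State.

(** * Normal forms *)

Section HalfNormalForm.
Variables (G : groupType) (q p : nat) (x y z : G).
Local Open Scope group_scope.

Lemma expgn_mod (g : G) m k : g ^+ m = 1 -> g ^+ (k %% m) = g ^+ k.
Proof. by move=> gm; rewrite {2}(divn_eq k m) expgnDr mulnC expgnA gm expg1n mul1g. Qed.

Lemma expg_ordD m (g : G) (i j : 'I_m.+1) : g ^+ m.+1 = 1 ->
  g ^+ (i + j)%R = g ^+ i * g ^+ j.
Proof. by move=> gm; rewrite [val _]/= expgn_mod // expgnDr. Qed.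

Lemma expg_ordN m (g : G) (i : 'I_m.+1) : g ^+ m.+1 = 1 ->
  g ^+ (- i)%R = (g ^+ i)^-1.
Proof. by move=> gm; apply/esym/mulg1_eq; rewrite -expg_ordD // subrr. Qed.

Lemma expg_Zp1 m (g : G) : g ^+ m.+1 = 1 -> g ^+ (@Zp1 m) = g.
Proof. by move=> gm; rewrite [val _]/= expgn_mod // expg1. Qed.

Lemma expg_turn m (g : G) e : g ^+ m.+1 = 1 ->
  g ^+ (turn e (@Zp1 m)) = if e then g else g^-1.
Proof. by move=> gm; case: e; rewrite /turn ?expg_ordN // expg_Zp1. Qed.

Lemma invert_inv (g a : G) : g * a = a^-1 * g -> g * a^-1 = a * g.
Proof. by move=> ga; apply: (mulIg a); rewrite mulgVK -mulgA ga mulVKg. Qed.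

Hypotheses (xx : x * x = 1) (yy : y * y = 1) (zz : z * z = 1).
Hypothesis xyzyz : (x * y * z * y * z) ^+ 2 = 1.
Hypothesis xy_ord : (x * y) ^+ p.+1 = 1.
Hypothesis yz_ord : (y * z) ^+ (2 * q.+1) = 1.

(** The section is applied to [(x0, x1, x2)] and to [(x4, x3, x2)]; this element is then [a] and [b]
    respectively. *)
Let a := (y * z) ^+ 2.

Lemma invol_inv (g : G) : g * g = 1 -> g^-1 = g.
Proof. exact: mulg1_eq. Qed.

Lemma half_aE : a = y * (z * (y * z)).
Proof. by rewrite /a expg2 !mulgA. Qed.

Lemma half_aV : a^-1 = z * (y * (z * y)).
Proof. by rewrite half_aE !invgM (invol_inv yy) (invol_inv zz) !mulgA. Qed.

Lemma half_ya : y * a = a^-1 * y.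
Proof. by rewrite half_aV half_aE !mulgA yy mul1g -!mulgA yy mulg1. Qed.

Lemma half_za : z * a = a^-1 * z.
Proof. by rewrite half_aV half_aE !mulgA. Qed.

(** The relator is the square of [x a], and [x] is an involution. *)
Lemma half_xa : x * a = a^-1 * x.
Proof.
have /mulg1_eq : (x * a) * (x * a) = 1.
  by rewrite -[RHS]xyzyz expg2 half_aE !mulgA.
by rewrite invgM (invol_inv xx).
Qed.

Lemma half_a_ord : a ^+ q.+1 = 1.
Proof. by rewrite /a -expgnA yz_ord. Qed.

(** Moving the middle generator past an inner one costs a factor [a], the extra term of
    [inner true]. *)
Lemma half_mid_inner : z * y = y * a * z.
Proof. by rewrite half_ya half_aV -!mulgA (mulgA y y) yy mul1g zz mulg1. Qed.

Lemma commute_a_xy : commute (x * y) a.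
Proof. by rewrite /commute -mulgA half_ya mulgA (invert_inv half_xa) mulgA. Qed.

Definition half_nf (h : hstate q p) : G :=
  let: (u, r, e) := h in a ^+ u * (x * y) ^+ r * x ^+ e.

Lemma half_nf0 : half_nf (0%R, 0%R, false) = 1.
Proof. by rewrite /half_nf /= !expg0 !mulg1. Qed.

Lemma half_nf_outer h : half_nf (outer h) = half_nf h * x.
Proof.
by case: h => [[u r] []] /=; rewrite ?expg1 ?expg0 ?mulg1 // -mulgA xx mulg1.
Qed.

Lemma half_nf_inner_false h : half_nf (inner false h) = half_nf h * y.
Proof.
case: h => [[u r] e]; rewrite /half_nf /inner addr0 expg_ordD // expg_turn //.
case: e; rewrite ?expg0 ?expg1 ?mulg1 !mulgA //.
by rewrite invgM (invol_inv xx) (invol_inv yy) -!mulgA xx mulg1.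
Qed.

Lemma half_nf_inner_true h : half_nf (inner true h) = half_nf h * (y * a).
Proof.
have -> : half_nf (inner true h) = a ^+ turn h.2 (@Zp1 q) * half_nf (inner false h).
  case: h => [[u r] e]; rewrite /half_nf /inner addr0 expg_ordD; last exact: half_a_ord.
  by rewrite !mulgA -!expgnDr addnC.
rewrite half_nf_inner_false half_ya !mulgA; congr (_ * y).
(* It remains to move [a^-1] to the left: [(x y)^r] commutes with it and [x] inverts it, whence the
   sign [turn e]. *)
rewrite expg_turn; last exact: half_a_ord.
case: h => [[u r] e]; rewrite /half_nf.
have ca : commute a (a ^+ u * (x * y) ^+ r).
  apply: commuteM; apply: commuteX => //; exact/commute_sym/commute_a_xy.
case: e; rewrite ?expg1 ?expg0 ?mulg1.
  by rewrite mulgA ca -[RHS]mulgA (invert_inv half_xa) [RHS]mulgA.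
exact/esym/(commuteV (commute_sym ca)).
Qed.

Lemma half_nf_commute g h : commute g a -> commute g x -> commute g y ->
  commute g (half_nf h).
Proof.
move=> ga gx gy; case: h => [[u r] e]; rewrite /half_nf.
by do ?[exact: commuteX|apply: commuteM]; apply: commuteX; apply: commuteM.
Qed.

End HalfNormalForm.

(** * Induction in groups generated by involutions, and membership of half normal forms *)

Section InvolutionGeneration.
Variables (G : groupType) (A : set G) (P : G -> Prop).
Local Open Scope group_scope.
Hypothesis A_invol : forall a, A a -> a * a = 1.

(** The elements whose right translation preserves [Q] in both directions form a subgroup; the
    equivalence is what gives closure under inverses. It contains [A] because each generator undoes
    itself. *)
Lemma generated_indr g : P 1 ->
  (forall g a, generated A g -> A a -> P g -> P (g * a)) -> generated A g -> P g.
Proof.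
move=> P1 PM Ag; have [A1 AM AV] := generated_subgroup A.
pose Q g := generated A g /\ P g.
suff [] : Q g by [].
have Q1 : Q 1 by [].
have QM h a : A a -> Q h -> Q (h * a).
  by move=> Aa [Ah Ph]; split; [apply: AM => //; exact: sub_generated|exact: PM].
suff /(_ 1) [] : forall h, Q h <-> Q (h * g) by rewrite mul1g => + _; apply.
apply: (@generated_ind _ A [set g | forall h, Q h <-> Q (h * g)]) Ag.
  split=> [h|h k Hh Hk l|h Hh k] /=; first by rewrite mulg1.
    by rewrite mulgA -Hk -Hh.
  by rewrite (Hh (k * h^-1)) mulgVK.
move=> a Aa h; split; first exact: QM.
by move=> /(QM _ _ Aa); rewrite -mulgA A_invol // mulg1.
Qed.

End InvolutionGeneration.

Lemma generated_indl (G : groupType) (A : set G) (P : G -> Prop) g :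
    (forall a, A a -> a * a = 1)%g -> P 1%g ->
    (forall g a, generated A g -> A a -> P g -> P (a * g)%g) ->
  generated A g -> P g.
Proof.
move=> A_invol P1 PM Ag; have [_ _ AV] := generated_subgroup A.
rewrite -[g]invgK; apply: (@generated_indr _ A (fun h => P h^-1%g)) => //.
- by rewrite invg1.
- move=> h a Ah Aa; rewrite invgM (mulg1_eq (A_invol a Aa)).
  by apply: PM => //; apply: AV.
- exact: AV.
Qed.

Section SubgroupMembership.
Variables (G : groupType) (H : set G).
Hypothesis sgH : subgroup H.
Local Open Scope group_scope.

Lemma subgroup1 : H 1. Proof. by case: sgH. Qed.

Lemma subgroupM g h : H g -> H h -> H (g * h).
Proof. by case: sgH => _ HM _; apply: HM. Qed.

Lemma subgroupV g : H g -> H g^-1.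
Proof. by case: sgH => _ _; apply. Qed.

Lemma subgroupX g n : H g -> H (g ^+ n).
Proof.
move=> Hg; elim: n => [|n IH]; first by rewrite expg0; apply: subgroup1.
by rewrite expgS; apply: subgroupM.
Qed.

(** Each alternative replaces a missing generator by the matching condition of [in_par]. The product
    splits as [a^u] times [(x y)^r x^e]; without [x] the second factor is 1 or [(x y)^-1 x = y], and
    without [y] it is a power of [x]. *)
Lemma half_nf_mem q p (x y z : G) (u : 'I_q.+1) (r : 'I_p.+1) e :
    (0 < p)%N -> x * x = 1 -> y * y = 1 -> (x * y) ^+ p.+1 = 1 ->
    H x \/ r = (if e then - Zp1 else 0)%R -> H y \/ (u = 0 /\ r = 0)%R ->
    H z \/ u = 0%R -> H (half_nf x y z (u, r, e)).
Proof.
move=> p_gt0 xx yy xy_ord Hx Hy Hz; rewrite /half_nf -mulgA.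
apply: subgroupM.
  case: Hy => [Hy|[-> _]]; last exact: subgroup1.
  case: Hz => [Hz|->]; last exact: subgroup1.
  by do 2!apply: subgroupX; apply: subgroupM.
case: Hx => [Hx|rE].
  apply: subgroupM; last by case: e => //; apply: subgroup1.
  case: Hy => [Hy|[_ ->]]; last exact: subgroup1.
  by apply: subgroupX; apply: subgroupM.
case: e rE => rE; last by rewrite rE mulg1; apply: subgroup1.
have {}rE : r = (- Zp1)%R := rE.
case: Hy => [Hy|[_ r0]].
  rewrite rE expg_ordN // expg_Zp1 // invgM (invol_inv xx) (invol_inv yy).
  by rewrite expg1 -mulgA xx mulg1.
(* With neither [x] nor [y] available, [e = true] would force [-1 = 0] modulo [p.+1], which [p_gt0]
   excludes. *)
have : Zp1 == 0%R :> 'I_p.+1 by rewrite -oppr_eq0 -rE r0.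
by rewrite -[Zp1]mulr1n Zp1_mulrn_eq0 dvdn1 eqSS; move: p_gt0; rewrite lt0n => /negPf->.
Qed.

End SubgroupMembership.

(** * Words and parabolic subgroups of [Gamma] *)

Section GammaWords.
Variables p1 p2 p3 p4 : nat.
Local Open Scope group_scope.
Local Notation Gamma := (Gamma p1 p2 p3 p4).

Definition xgen (j : nat) : Gamma := Gamma_gen p1 p2 p3 p4 (inord j).

Local Notation x := xgen.

Lemma Gamma_genE (j : 'I_5) : Gamma_gen p1 p2 p3 p4 j = x j.
Proof. by rewrite /xgen inord_val. Qed.

Lemma word_powE s k : \pi_(presented (Gamma_relators p1 p2 p3 p4))%qT (word_pow s k) =
  (foldr (fun i g => x i * g) 1 s) ^+ k :> Gamma.
Proof.
elim: k => [|k IH] //; rewrite expgS -{}IH.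
have -> : word_pow s k.+1 = [seq (inord i, true) | i <- s] ++ word_pow s k by [].
rewrite -presented_piM; congr (_ * _).
elim: s => [|i s IH] //=; rewrite -{}IH /xgen /Gamma_gen /presented_gen.
by rewrite presented_piM.
Qed.

Lemma x_relation s k : Gamma_relators p1 p2 p3 p4 (word_pow s k) ->
  (foldr (fun i g => x i * g) 1 s) ^+ k = 1.
Proof. by move=> /presented_relator; rewrite word_powE. Qed.

Lemma x_relation_pair j : (0 < j < 5)%N ->
  (x j.-1 * x j) ^+ nth 0%N [:: p1; p2; p3; p4] j.-1 = 1.
Proof.
have pair i k p : Gamma_relators p1 p2 p3 p4 (word_pow [:: i; k] p) -> (x i * x k) ^+ p = 1.
  by move=> /x_relation; rewrite /foldr mulg1.
by case: j => [|[|[|[|[|j]]]]] // _; apply: pair; constructor.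
Qed.

Lemma x_invol j : x j * x j = 1.
Proof. exact: Gamma_gen_invol. Qed.

Lemma x_commute j k : (j.+1 < k < 5)%N -> commute (x j) (x k).
Proof.
case/andP=> jk k5; apply: Gamma_gen_commute.
by rewrite !inordK //; apply: ltn_trans k5; apply: ltn_trans jk.
Qed.

Definition par (J : set 'I_5) : set Gamma := generated (Gamma_gen p1 p2 p3 p4 @` J).

Lemma par_subgroup J : subgroup (par J).
Proof. exact: generated_subgroup. Qed.

Lemma par_gen (J : set 'I_5) (j : 'I_5) : J j -> par J (x j).
Proof. by move=> Jj; apply: sub_generated; exists j; rewrite // Gamma_genE. Qed.

Lemma par_indr (J : set 'I_5) (P : Gamma -> Prop) g : P 1 ->
  (forall g (j : 'I_5), par J g -> J j -> P g -> P (g * x j)) -> par J g -> P g.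
Proof.
move=> P1 PM; apply: generated_indr => //.
  by move=> _ [j _ <-]; apply: Gamma_gen_invol.
by move=> h _ Jh [j Jj <-]; rewrite Gamma_genE; apply: PM.
Qed.

Lemma par_indl (J : set 'I_5) (P : Gamma -> Prop) g : P 1 ->
  (forall g (j : 'I_5), par J g -> J j -> P g -> P (x j * g)) -> par J g -> P g.
Proof.
move=> P1 PM; apply: generated_indl => //.
  by move=> _ [j _ <-]; apply: Gamma_gen_invol.
by move=> h _ Jh [j Jj <-]; rewrite Gamma_genE; apply: PM.
Qed.

Lemma par_setT g : par setT g.
Proof.
rewrite -[g]reprK; elim: (repr g) => [|[i b] w IH].
  exact: (subgroup1 (par_subgroup _)).
rewrite -cat1s -presented_piM; apply: (subgroupM (par_subgroup _)) => //.
case: b; first by apply: sub_generated; exists i.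
have <- : (Gamma_gen p1 p2 p3 p4 i)^-1 = \pi_(presented _)%qT [:: (i, false)].
  exact: presented_invE.
by apply: (subgroupV (par_subgroup _)); apply: sub_generated; exists i.
Qed.

End GammaWords.

(** * Commutation relations in [Gamma], and right multiplication of normal forms *)

Section InvolutionCommute.
Variable G : groupType.
Local Open Scope group_scope.

Lemma invol_commute (g h : G) :
  g * g = 1 -> h * h = 1 -> (g * h) ^+ 2 = 1 -> commute g h.
Proof.
move=> gg hh; rewrite expg2 => /mulg1_eq.
by rewrite invgM (invol_inv gg) (invol_inv hh).
Qed.

Lemma commute_conj (z g h : G) :
  z * z = 1 -> commute g (z * h * z) -> commute (z * g * z) h.
Proof.
move=> zz ghz; rewrite /commute.
have -> : z * g * z * h = z * (g * (z * h * z)) * z by rewrite !mulgA -[RHS]mulgA zz mulg1.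
by rewrite ghz !mulgA zz mul1g.
Qed.

Lemma commute_invert2 (g h : G) : g * h = h^-1 * g -> commute (g ^+ 2) h.
Proof.
by move=> gh; rewrite /commute expg2 -mulgA gh mulgA (invert_inv gh) mulgA.
Qed.

End InvolutionCommute.

Section GammaCoordinates.
Variables q2 q3 p1 p4 : nat.
Local Open Scope group_scope.

Local Notation Gamma := (Gamma p1.+1 (2 * q2.+1)%N (2 * q3.+1)%N p4.+1).
Local Notation x := (xgen p1.+1 (2 * q2.+1) (2 * q3.+1) p4.+1).
Local Notation par := (@par p1.+1 (2 * q2.+1) (2 * q3.+1) p4.+1).
Local Notation state := (state q2 q3 p1 p4).

Lemma x01_ord : (x 0 * x 1) ^+ p1.+1 = 1.
Proof. by have := x_relation (rel_p1 p1.+1 (2 * q2.+1) (2 * q3.+1) p4.+1); rewrite /= mulg1. Qed.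

Lemma x12_ord : (x 1 * x 2) ^+ (2 * q2.+1) = 1.
Proof. by have := x_relation (rel_p2 p1.+1 (2 * q2.+1) (2 * q3.+1) p4.+1); rewrite /= mulg1. Qed.

Lemma x32_ord : (x 3 * x 2) ^+ (2 * q3.+1) = 1.
Proof.
have := x_relation (rel_p3 p1.+1 (2 * q2.+1) (2 * q3.+1) p4.+1).
rewrite /foldr mulg1 => /(congr1 (fun g : Gamma => g^-1)); rewrite invg1 -expVgn invgM.
by rewrite (invol_inv (x_invol _ _ _ _ 2)) (invol_inv (x_invol _ _ _ _ 3)).
Qed.

Lemma x43_ord : (x 4 * x 3) ^+ p4.+1 = 1.
Proof.
have := x_relation (rel_p4 p1.+1 (2 * q2.+1) (2 * q3.+1) p4.+1).
rewrite /foldr mulg1 => /(congr1 (fun g : Gamma => g^-1)); rewrite invg1 -expVgn invgM.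
by rewrite (invol_inv (x_invol _ _ _ _ 3)) (invol_inv (x_invol _ _ _ _ 4)).
Qed.

Lemma x01212 : (x 0 * x 1 * x 2 * x 1 * x 2) ^+ 2 = 1.
Proof.
have := x_relation (rel_01212 p1.+1 (2 * q2.+1) (2 * q3.+1) p4.+1).
by rewrite /foldr mulg1 !mulgA.
Qed.

Lemma x43232 : (x 4 * x 3 * x 2 * x 3 * x 2) ^+ 2 = 1.
Proof.
have := x_relation (rel_43232 p1.+1 (2 * q2.+1) (2 * q3.+1) p4.+1).
by rewrite /foldr mulg1 !mulgA.
Qed.

Lemma x1_commute_x232 : commute (x 1) (x 2 * x 3 * x 2).
Proof.
apply: invol_commute; first exact: x_invol.
  by rewrite -!mulgA (mulgA (x 2) (x 2)) x_invol mul1g (mulgA (x 3)) x_invol mul1g x_invol.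
have := x_relation (rel_1232 p1.+1 (2 * q2.+1) (2 * q3.+1) p4.+1).
by rewrite /foldr mulg1 !mulgA.
Qed.

Lemma x3_commute_x212 : commute (x 3) (x 2 * x 1 * x 2).
Proof.
by apply/commute_sym/commute_conj; [exact: x_invol|exact: x1_commute_x232].
Qed.

Let a := (x 1 * x 2) ^+ 2.
Let b := (x 3 * x 2) ^+ 2.

(** [a] is the product of [x1] and its conjugate [x2 x1 x2], and [x3] commutes with both. *)
Lemma x3_commute_a : commute (x 3) a.
Proof.
have -> : a = x 1 * (x 2 * x 1 * x 2) by rewrite /a expg2 !mulgA.
by apply: commuteM; [apply/commute_sym/x_commute|apply: x3_commute_x212].
Qed.

Lemma x1_commute_b : commute (x 1) b.
Proof.
have -> : b = x 3 * (x 2 * x 3 * x 2) by rewrite /b expg2 !mulgA.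
by apply: commuteM; [apply: x_commute|apply: x1_commute_x232].
Qed.

Lemma x0_commute_b : commute (x 0) b.
Proof. by apply/commuteX/commuteM; apply: x_commute. Qed.

Lemma x4_commute_a : commute (x 4) a.
Proof. by apply/commuteX/commuteM; apply/commute_sym/x_commute. Qed.

(** [x1] centralises [b] and [x2] inverts it, so [x1 x2] inverts [b] and its square centralises
    it. *)
Lemma a_commute_b : commute a b.
Proof.
apply: commute_invert2; rewrite -mulgA.
rewrite (half_za (x_invol _ _ _ _ 3) (x_invol _ _ _ _ 2)) mulgA.
by rewrite (commuteV x1_commute_b) -mulgA.
Qed.

Definition left_nf (h : hstate q2 p1) : Gamma := half_nf (x 0) (x 1) (x 2) h.
Definition right_nf (k : hstate q3 p4) : Gamma := half_nf (x 4) (x 3) (x 2) k.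
Definition nf (t : state) : Gamma :=
  let: (h, k, n) := t in left_nf h * right_nf k * x 2 ^+ (n : bool).

Lemma commute_right_nf g k :
  commute g b -> commute g (x 4) -> commute g (x 3) -> commute g (right_nf k).
Proof. exact: half_nf_commute. Qed.

Lemma nf_base : nf (base q2 q3 p1 p4) = 1.
Proof. by rewrite /nf /base /left_nf /right_nf !half_nf0 expg0 !mulg1. Qed.

Lemma x2X (n : bool) : x 2 ^+ n * x 2 = x 2 ^+ ~~ n.
Proof. by case: n; rewrite ?expg1 ?expg0 ?mul1g // x_invol. Qed.

Lemma nf_step (j : 'I_5) t : nf (step j t) = nf t * x j.
Proof.
have xx := x_invol p1.+1 (2 * q2.+1) (2 * q3.+1) p4.+1.
have right_x0 k : commute (x 0) (right_nf k).
  by apply: commute_right_nf; [exact: x0_commute_b| |]; apply: x_commute.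
have right_x1 k : commute (x 1) (right_nf k).
  by apply: commute_right_nf; [exact: x1_commute_b| |]; apply: x_commute.
have right_a k : commute a (right_nf k).
  apply: commute_right_nf; first exact: a_commute_b.
    exact/commute_sym/x4_commute_a.
  exact/commute_sym/x3_commute_a.
have x02 n : x 2 ^+ n * x 0 = x 0 * x 2 ^+ n.
  by apply/esym/commuteX/x_commute.
have x24 n : x 2 ^+ n * x 4 = x 4 * x 2 ^+ n.
  by apply/esym/commuteX/commute_sym/x_commute.
case: t => [[h k] n]; case: j => [[|[|[|[|[|j]]]]] j5] //=.
- rewrite /left_nf half_nf_outer // -!mulgA x02; congr (_ * _).
  by rewrite !mulgA right_x0.
- case: n.
    rewrite /left_nf half_nf_inner_true ?x01_ord ?x12_ord ?x01212 //.
    (* By [x2 x1 = x1 a x2], the factor to be moved left past the right half is [x1 a], which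
       commutes with it. *)
    rewrite expg1 -[RHS]mulgA (half_mid_inner (xx 1%N) (xx 2)) -/a [RHS]mulgA.
    congr (_ * x 2); rewrite -[LHS]mulgA -[RHS]mulgA; congr (_ * _).
    by apply: commute_sym; apply: commuteM; apply: commute_sym.
  rewrite /left_nf half_nf_inner_false ?x01_ord // expg0 !mulg1 -!mulgA.
  by rewrite right_x1.
- by rewrite -[RHS]mulgA x2X.
- case: n.
    rewrite /right_nf half_nf_inner_true ?x43_ord ?x32_ord ?x43232 //.
    by rewrite expg1 -!mulgA (half_mid_inner (xx 3) (xx 2)) -!mulgA.
  by rewrite /right_nf half_nf_inner_false ?x43_ord // expg0 !mulg1 -!mulgA.
- by rewrite /right_nf half_nf_outer // -!mulgA x24.
Qed.

End GammaCoordinates.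

Lemma card_finType (T : finType) : ([set: T] #= `I_#|T|)%card.
Proof.
apply: card_eq_trans (card_esym card_II).
have -> : [set: 'I_#|T|] = enum_rank @` [set: T].
  by apply/seteqP; split=> // i _; exists (enum_val i) => //; apply: enum_valK.
by apply/card_esym/inj_card_eq => s t _ _; apply: enum_rank_inj.
Qed.

(** * The action on coordinates and the intersection property *)

Section GammaAction.
Variables q2 q3 p1 p4 : nat.
Hypotheses (p1_gt0 : (0 < p1)%N) (p4_gt0 : (0 < p4)%N).
Hypothesis q2_dvd : (q2.+1 %| p1.+1)%N.
Hypothesis q3_dvd : (q3.+1 %| p4.+1)%N.
Local Open Scope group_scope.

Local Notation Gamma := (Gamma p1.+1 (2 * q2.+1)%N (2 * q3.+1)%N p4.+1).
Local Notation x := (xgen p1.+1 (2 * q2.+1) (2 * q3.+1) p4.+1).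
Local Notation par := (@par p1.+1 (2 * q2.+1) (2 * q3.+1) p4.+1).
Local Notation state := (state q2 q3 p1 p4).

Definition act (t : state) (g : Gamma) : state := run (repr g) t.

(** Relators act trivially, so the representative chosen in [act] does not matter. *)
Lemma act_pi t w : act t (\pi_(presented _)%qT w) = run w t.
Proof. by apply: run_word_eq => //; apply: presented_repr. Qed.

Lemma act1 t : act t 1 = t.
Proof. exact: act_pi. Qed.

Lemma actM t g h : act t (g * h) = act (act t g) h.
Proof. by rewrite [LHS]act_pi run_cat. Qed.

Lemma act_x t j : (j < 5)%N -> act t (x j) = step j t.
Proof. by move=> j5; rewrite [LHS]act_pi /run /= inordK. Qed.

Lemma act_xx t i j : (i < 5)%N -> (j < 5)%N -> act t (x i * x j) = step j (step i t).
Proof. by move=> i5 j5; rewrite actM !act_x. Qed.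

Lemma actX t g n : act t (g ^+ n) = iter n (act^~ g) t.
Proof.
elim: n => [|n IH]; first by rewrite expg0 act1.
by rewrite expgSr actM IH.
Qed.

Lemma act_xxX t i j n : (i < 5)%N -> (j < 5)%N ->
  act t ((x i * x j) ^+ n) = iter n (fun t => step j (step i t)) t.
Proof. by move=> i5 j5; rewrite actX; apply: eq_iter => s; rewrite act_xx. Qed.

Definition coord (g : Gamma) : state := act (base q2 q3 p1 p4) g.

Lemma coord_mulx g (j : 'I_5) : coord (g * x j) = step j (coord g).
Proof. by rewrite /coord actM act_x. Qed.

Lemma coord1 : coord 1 = base q2 q3 p1 p4.
Proof. exact: act1. Qed.

(** Existence of the normal form: [nf] turns [step] into right multiplication, so the identity
    propagates along words. *)
Lemma coordK : cancel coord (@nf q2 q3 p1 p4).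
Proof.
move=> g; have := par_setT g; elim/par_indr: g / => [|g j _ _ IH].
  by rewrite coord1 nf_base.
by rewrite coord_mulx nf_step IH.
Qed.

Lemma inZp_ord m (i : 'I_m.+1) : (Zp1 *+ i)%R = i.
Proof. by rewrite Zp1_mulrn valZpK. Qed.

Lemma act_left_nf k (h : hstate q2 p1) :
  act ((0%R, 0%R, false), k, false) (left_nf q3 p4 h) = (h, k, false).
Proof.
case: h => [[u r] e]; rewrite /left_nf /half_nf !actM -expgnA act_xxX //.
rewrite act_xxX // iter_step12 iter_step01 iter_outer_inner !inZp_ord !add0r addr0.
by case: e; rewrite ?expg1 ?expg0 ?act1 // act_x.
Qed.

Lemma act_right_nf h (k : hstate q3 p4) :
  act (h, (0%R, 0%R, false), false) (right_nf q2 p1 k) = (h, k, false).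
Proof.
(* The earlier iteration lemmas [iter_step23] and [iter_step34] treat the opposite order of the
   letters. *)
have iter_step32 n v s :
    iter (2 * n) (fun t : state => step 2 (step 3 t)) (h, (v, s, false), false) =
    (h, ((v + Zp1 *+ n)%R, s, false), false).
  rewrite iter_double; elim: n => [|n IH]; first by rewrite /= mulr0n addr0.
  by rewrite iterS {}IH /turn /= mulrSr addr0 addrA subrK.
have iter_step43 n v s :
    iter n (fun t : state => step 3 (step 4 t)) (h, (v, s, false), false) =
    (h, (v, (s + Zp1 *+ n)%R, false), false).
  elim: n => [|n IH]; first by rewrite /= mulr0n addr0.
  by rewrite iterS {}IH /turn /= mulrSr addr0 addrA.
case: k => [[v s] d]; rewrite /right_nf /half_nf !actM -expgnA act_xxX //.
rewrite act_xxX // iter_step32 iter_step43 !inZp_ord !add0r.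
by case: d; rewrite ?expg1 ?expg0 ?act1 // act_x.
Qed.

(** Uniqueness of the normal form: acting on [base], each factor of [nf t] fills in its own
    coordinates and leaves the others alone. *)
Lemma nfK : cancel (@nf q2 q3 p1 p4) coord.
Proof.
case=> [[h k] n]; rewrite /coord /nf !actM act_left_nf act_right_nf.
by case: n; rewrite ?expg1 ?expg0 ?act1 // act_x.
Qed.

(* The condition satisfied by the coordinates of the elements of [Gamma_sub k]; for
   [k = 0] it says that [(x0 x1)^r x0^e] is [1] or [x1 = (x0 x1)^-1 x0]. *)
Definition in_par (k : nat) (t : state) : Prop :=
  let: ((u, r, e), (v, s, d), n) := t in
  match k with
  | 0 => r = if e then (- Zp1)%R else 0%R
  | 1 => u = 0%R /\ r = 0%R
  | 2 => [/\ u = 0%R, v = 0%R & n = false]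
  | 3 => v = 0%R /\ s = 0%R
  | _ => s = if d then (- Zp1)%R else 0%R
  end.

Lemma in_par_base k : in_par k (base q2 q3 p1 p4).
Proof. by case: k => [|[|[|[|k]]]]. Qed.

Lemma in_par_step (j k : 'I_5) t : j != k -> in_par k t -> in_par k (step j t).
Proof.
case: t => [[[[u r] e] [[v s] d]] n].
case: j k => [[|[|[|[|[|j]]]]] j5] [[|[|[|[|[|k]]]]] k5] //= _.
- by rewrite /turn; case: e => ->; rewrite ?addNr ?add0r.
- by case=> -> -> ->; rewrite addr0.
- by case=> -> -> ->; rewrite addr0.
- by rewrite /turn; case: d => ->; rewrite ?addNr ?add0r.
Qed.

Lemma par_coord (J : set 'I_5) (k : 'I_5) g : par J g -> ~ J k -> in_par k (coord g).
Proof.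
move=> Jg nJk; elim/par_indr: g / Jg => [|g j _ Jj IH].
  by rewrite coord1; apply: in_par_base.
rewrite coord_mulx; apply: in_par_step => //.
by apply/eqP => jk; apply: nJk; rewrite -jk.
Qed.

(** The condition of a missing generator collapses the factors of the normal form that would use it,
    leaving only generators in [J]. *)
Lemma nf_par (J : set 'I_5) t : (forall k : 'I_5, ~ J k -> in_par k t) -> par J (nf t).
Proof.
have parJ : subgroup (par J) := par_subgroup _ _ _ _ J.
have x_or j (j5 : (j < 5)%N) (Q : Prop) : (~ J (Ordinal j5) -> Q) -> par J (x j) \/ Q.
  move=> nJQ; have [Jj|/nJQ] := pselect (J (Ordinal j5)); last by right.
  by left; apply: (par_gen Jj).
case: t => [[[[u r] e] [[v s] d]] n] Jt.
have J0 := Jt (@Ordinal 5 0 isT); have J1 := Jt (@Ordinal 5 1 isT).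
have J2 := Jt (@Ordinal 5 2 isT); have J3 := Jt (@Ordinal 5 3 isT).
have J4 := Jt (@Ordinal 5 4 isT).
apply: (subgroupM parJ); first apply: (subgroupM parJ).
- apply: half_nf_mem => //; do ?exact: x_invol; first exact: x01_ord.
  + exact: x_or J0.
  + exact: x_or J1.
  + by apply: x_or => /J2 [].
- apply: half_nf_mem => //; do ?exact: x_invol; first exact: x43_ord.
  + exact: x_or J4.
  + exact: x_or J3.
  + by apply: x_or => /J2 [].
- have [|[_ _ ->]] := x_or 2 isT _ J2; last exact: (subgroup1 parJ).
  exact: subgroupX.
Qed.

(** The intersection property: by [par_coord], lying in [Gamma_sub k] for all [k] outside [J] gives
    every condition that [nf_par] asks for. *)
Lemma par_bigcap (J : set 'I_5) g :
  par J g <-> forall k : 'I_5, ~ J k -> Gamma_sub k g.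
Proof.
split=> [Jg k nJk|Jg].
  apply: generatedS Jg => _ [j Jj <-]; exists j => //=.
  by apply/eqP => jk; apply: nJk; rewrite -jk.
rewrite -[g]coordK; apply: nf_par => k /Jg.
by move=> /par_coord; apply => /=; rewrite eqxx.
Qed.

(** * Order of the group, parity, and orders of the products of consecutive generators *)

Lemma Gamma_card :
  ([set: Gamma] #= `I_(2 * (p1.+1 * (2 * q2.+1) * (2 * q3.+1) * p4.+1)))%card.
Proof.
have -> : [set: Gamma] = @nf q2 q3 p1 p4 @` [set: state].
  by apply/seteqP; split=> // g _; exists (coord g) => //; apply: coordK.
apply: card_eq_trans (inj_card_eq _) _; first by move=> s t _ _ /(can_inj nfK).
pose T : finType := ('I_q2.+1 * 'I_p1.+1 * bool * ('I_q3.+1 * 'I_p4.+1 * bool) * bool)%type.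
have <- : #|T| = (2 * (p1.+1 * (2 * q2.+1) * (2 * q3.+1) * p4.+1))%N.
  by rewrite !card_prod !card_bool !card_ord; lia.
exact: card_finType.
Qed.

(** Each generator flips exactly one of the three bits, so this is word length modulo 2. *)
Definition parity (g : Gamma) : bool :=
  let: ((_, e), (_, d), n) := coord g in e (+) d (+) n.

Lemma parity_mulx g (j : 'I_5) : parity (g * x j) = ~~ parity g.
Proof.
rewrite /parity coord_mulx; case: (coord g) => [[[[u r] e] [[v s] d]] n].
by case: j => [[|[|[|[|[|j]]]]] j5] //=; case: e; case: d; case: n.
Qed.

Lemma parity1 : parity 1 = false.
Proof. by rewrite /parity coord1. Qed.

Lemma parityM g h : parity (g * h) = parity g (+) parity h.
Proof.
have := par_setT h; elim/par_indr: h / => [|h j _ _ IH].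
  by rewrite mulg1 parity1 addbF.
by rewrite mulgA !parity_mulx IH addbN.
Qed.

(** Acting on [base], the power shifts a single exponent by [n] or [n./2], up to sign, and this
    shift must vanish in its residue ring. *)
Lemma xxX_order (j : nat) n : (0 < j < 5)%N -> (x j.-1 * x j) ^+ n = 1 ->
  nth 0%N [:: p1.+1; 2 * q2.+1; 2 * q3.+1; p4.+1]%N j.-1 %| n.
Proof.
(* For the two middle pairs exactly one letter is [x2], so the last bit shows that [n] is even and
   the double-round formulas apply. *)
have parity_iter (b : bool) i t : (i = 1 \/ i = 2)%N -> t.2 = b ->
    (iter n (fun t : state => step i.+1 (step i t)) t).2 = b (+) odd n.
  move=> i12 <-; elim: n => [|m IH]; first by rewrite addbF.
  rewrite iterS; case: (iter m _ t) IH => [[h k] c] /= ->.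
  by case: i12 => ->; rewrite addbN.
case/andP; case: j => [|[|[|[|[|j]]]]] //= _ _ /(congr1 coord).
- rewrite coord1 /coord act_xxX // /base iter_step01 iter_outer_inner !add0r => E.
  have /eqP : (Zp1 *+ n = 0 :> 'I_p1.+1)%R := congr1 (fun t : state => t.1.1.1.2) E.
  by rewrite Zp1_mulrn_eq0.
- move=> E; have := parity_iter false 1%N (base q2 q3 p1 p4) (or_introl erefl) erefl.
  rewrite -act_xxX // [act _ _]E coord1 addFb => /esym/negbT n_even.
  move: E; rewrite -(even_halfK n_even) -mul2n.
  rewrite coord1 /coord act_xxX // /base iter_step12 !add0r => E.
  have /eqP : (Zp1 *+ n./2 = 0 :> 'I_q2.+1)%R := congr1 (fun t : state => t.1.1.1.1) E.
  by rewrite Zp1_mulrn_eq0 => dv; apply: dvdn_mul.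
- move=> E; have := parity_iter false 2 (base q2 q3 p1 p4) (or_intror erefl) erefl.
  rewrite -act_xxX // [act _ _]E coord1 addFb => /esym/negbT n_even.
  move: E; rewrite -(even_halfK n_even) -mul2n.
  rewrite coord1 /coord act_xxX // /base iter_step23 !add0r => E.
  have /eqP : (- Zp1 *+ n./2 = 0 :> 'I_q3.+1)%R := congr1 (fun t : state => t.1.2.1.1) E.
  by rewrite mulNrn oppr_eq0 Zp1_mulrn_eq0 => dv; apply: dvdn_mul.
- rewrite coord1 /coord act_xxX // /base iter_step34 iter_inner_outer !add0r => E.
  have /eqP : (- Zp1 *+ n = 0 :> 'I_p4.+1)%R := congr1 (fun t : state => t.1.2.1.2) E.
  by rewrite mulNrn oppr_eq0 Zp1_mulrn_eq0.
Qed.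

End GammaAction.

(** * Faces and flags *)

Section Faces.
Variables p1 p2 p3 p4 : nat.
Local Open Scope order_scope.
Local Open Scope group_scope.
Local Notation Gamma := (Gamma p1 p2 p3 p4).
Local Notation x := (xgen p1 p2 p3 p4).
Local Notation par := (@par p1 p2 p3 p4).
Local Notation face := (Gamma_poset p1 p2 p3 p4).
Implicit Types (F H K : face) (g h : Gamma) (n m : nat) (C D : set face).

(* Ranks are shifted by one, so that the least face has [frank] 0. *)
Definition frank F : nat :=
  match F with LeastFace => 0 | CosetFace j _ _ => j.+1 | GreatestFace => 6 end.

(** The improper faces count as the whole group, so that incidence always means having a common
    element. *)
Definition through g F : Prop := if F is CosetFace j A _ then A g else True.

(* For [n = 0] and [n = 6] this is the whole group, as no generator is excluded. *)
Definition fstab n : set Gamma := par [set k : 'I_5 | k.+1 != n].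

Lemma Gamma_coset_rcoset (j : 'I_5) g : Gamma_coset j (rcoset (Gamma_sub j) g).
Proof. by exists g. Qed.

(** At [n = 6] the failing [insub] yields the greatest face, as it does beyond; hence the bound
    [n <= 6] in rank statements. *)
Definition face_at n g : face :=
  if n is j.+1 then
    if insub j is Some i then CosetFace (Gamma_coset_rcoset i g)
    else GreatestFace p1 p2 p3 p4
  else LeastFace p1 p2 p3 p4.

#[local] Arguments face_at : simpl never.

Lemma frankE F : Gamma_rank F = ((frank F)%:Z - 1)%R.
Proof. by case: F => [|j A cA|] //=; rewrite intS addrAC subrr add0r. Qed.

Lemma frank_le6 F : (frank F <= 6)%N.
Proof. by case: F => [|j A cA|] //=; apply: ltnW; rewrite ltnS. Qed.

Lemma frank_face_at n g : (n <= 6)%N -> frank (face_at n g) = n.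
Proof.
case: n => [|n] //= n6; rewrite /face_at; case: insubP => [i _ <-//|/= ].
by rewrite -leqNgt => n5; apply/eqP; rewrite eqn_leq ltnS n5.
Qed.

Lemma through_fstab F g h : through g F -> (through h F <-> fstab (frank F) (h * g^-1)).
Proof.
case: F => [|j A cA|] /= Ag.
- split=> // _; apply: generatedS (par_setT (h * g^-1)).
  by apply: image_subset => k _.
- by rewrite (Gamma_coset_eq cA Ag); apply: rcosetP.
- split=> // _; apply: generatedS (par_setT (h * g^-1)).
  by apply: image_subset => k _ /=; rewrite eqSS neq_ltn ltn_ord.
Qed.

Lemma fstab_subgroup n : subgroup (fstab n).
Proof. exact: par_subgroup. Qed.

Lemma through_mul F g s : fstab (frank F) s -> (through (s * g) F <-> through g F).
Proof.
move=> Fs; split=> Fg; last by apply/(through_fstab _ Fg); rewrite mulgK.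
apply/(through_fstab _ Fg); rewrite invgM mulgA mulgV mul1g.
exact: (subgroupV (fstab_subgroup _)).
Qed.

Lemma through_face_at n g : through g (face_at n g).
Proof.
case: n => [|n] //=; rewrite /face_at; case: insubP => // i _ _.
by apply: rcoset_refl; apply: Gamma_sub_subgroup.
Qed.

Lemma through_ex F : exists g, through g F.
Proof.
case: F => [|j A cA|]; [by exists 1| |by exists 1].
case: (cA) => g eA; exists g; rewrite /= eA.
by apply: rcoset_refl; apply: Gamma_sub_subgroup.
Qed.

Lemma face_eq F H g : frank F = frank H -> through g F -> through g H -> F = H.
Proof.
case: F H => [|j A cA|] [|k B cB|] //=; do ?[by case=> jk; have := ltn_ord j; rewrite jk].
  move=> [/val_inj jk]; case: k / jk cB => cB Ag Bg.
  have AB : A = B by rewrite (Gamma_coset_eq cA Ag) (Gamma_coset_eq cB Bg).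
  by case: B / AB cB {Bg} => cB; congr CosetFace; apply: Prop_irrelevance.
by case=> k5; have := ltn_ord k; rewrite -k5.
Qed.

Lemma face_atE F g : through g F -> F = face_at (frank F) g.
Proof.
move=> Fg; apply: (face_eq _ Fg (through_face_at _ g)).
by rewrite frank_face_at ?frank_le6.
Qed.

Lemma face_leP F H :
  F <= H <-> (frank F <= frank H)%N /\ exists g, through g F /\ through g H.
Proof.
case: F H => [|j A cA|] [|k B cB|].
- by split=> // _; split=> //; exists 1.
- by split=> // _; split=> //; have [g] := through_ex (CosetFace cB); exists g.
- by split=> // _; split=> //; exists 1.
- by split=> // -[].
- split=> [/andP[jk /asboolP[g [Ag Bg]]]|[jk [g [Ag Bg]]]].
    by split=> //; exists g.
  by apply/andP; split=> //; apply/asboolP; exists g.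
- split=> // _; split; first exact: ltnW (ltn_ord _).
  by have [g] := through_ex (CosetFace cA); exists g.
- by split=> // -[].
- by split=> // -[]; rewrite /= ltnS leqNgt ltn_ord.
- by split=> // _; split=> //; exists 1.
Qed.

Lemma face_le F H g :
  through g F -> through g H -> (frank F <= frank H)%N -> F <= H.
Proof. by move=> Fg Hg FH; apply/face_leP; split=> //; exists g. Qed.

Lemma face_lt_rank F H : F < H -> (frank F < frank H)%N.
Proof.
rewrite lt_neqAle => /andP[FH /face_leP[le_FH [g [Fg Hg]]]].
rewrite ltn_neqAle le_FH andbT; apply: contra FH => /eqP eq_rank.
by apply/eqP; apply: face_eq Fg Hg.
Qed.

Lemma face_lt F H g :
  through g F -> through g H -> (frank F < frank H)%N -> F < H.
Proof.
move=> Fg Hg FH; rewrite lt_neqAle (face_le Fg Hg (ltnW FH)) andbT.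
by apply: contraTneq FH => ->; rewrite ltnn.
Qed.

Lemma face_at_lt n m g : (n < m <= 6)%N -> face_at n g < face_at m g.
Proof.
case/andP=> nm m6; apply: (face_lt (through_face_at n g) (through_face_at m g)).
by rewrite !frank_face_at // (leq_trans (ltnW nm)).
Qed.

Lemma face_at_le n m g : (n <= m <= 6)%N -> face_at n g <= face_at m g.
Proof.
case/andP=> nm m6; apply: (face_le (through_face_at n g) (through_face_at m g)).
by rewrite !frank_face_at // (leq_trans nm).
Qed.

Lemma fstab_decomp n s : fstab n s ->
  exists u v, [/\ par [set k : 'I_5 | (k.+1 < n)%N] u,
                  par [set k : 'I_5 | (n < k.+1)%N] v & s = u * v].
Proof.
move=> ns; have [n5|n5] := ltnP n.-1 5; last first.
  exists s, 1; split; last by rewrite mulg1.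
    apply: generatedS (par_setT s); apply: image_subset => k _ /=.
    by case: n n5 {ns} => // n n5; rewrite ltnS (leq_trans (ltn_ord k)).
  exact: (subgroup1 (par_subgroup _ _ _ _ _)).
case: n n5 ns => [_ s0|j j5 ns].
  exists 1, s; split; last by rewrite mul1g.
    exact: (subgroup1 (par_subgroup _ _ _ _ _)).
  by apply: generatedS (par_setT s); apply: image_subset => k _.
exact: (@Gamma_sub_decomp p1 p2 p3 p4 (Ordinal j5)).
Qed.

Lemma fstab_par n (J : set 'I_5) : (forall k, J k -> k.+1 != n) -> par J `<=` fstab n.
Proof. by move=> Jn; apply: generatedS; apply: image_subset => k /Jn. Qed.

Lemma fstab_x n (k : 'I_5) : k.+1 != n -> fstab n (x k).
Proof. by move=> kn; apply: par_gen. Qed.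

(** Pairwise incidence yields one common element. In the generalised claim [A] stands for the next
    face above the ranks considered: stable under the lower generators and meeting every lower face
    of the chain. *)
Lemma chain_through C : chain C -> exists g, forall F, C F -> through g F.
Proof.
move=> chC.
suff /(_ 7 setT) [] : forall n (A : set Gamma), A !=set0 ->
    (forall k : 'I_5, (k.+1 < n)%N -> forall h, A h -> A (x k * h)) ->
    (forall F, C F -> (frank F < n)%N -> exists h, A h /\ through h F) ->
    exists g, A g /\ forall F, C F -> (frank F < n)%N -> through g F.
- by exists 1.
- by [].
- by move=> F _ _; have [g] := through_ex F; exists g.
- by move=> g [_ Cg]; exists g => F CF; apply: Cg; rewrite ?ltnS ?frank_le6.
elim=> [|n IH] A [g0 Ag0] A_stab AC; first by exists g0.
have [[B [CB rB]]|nB] := pselect (exists B, C B /\ frank B = n); last first.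
  have [||F CF Fn|g [Ag Cg]] := IH A; first by exists g0.
  - by move=> k kn; apply: A_stab; apply: ltnW.
  - by apply: AC => //; apply: ltnW.
  exists g; split=> // F CF; rewrite ltnS leq_eqVlt => /orP[/eqP rF|]; last exact: Cg.
  by case: nB; exists F.
(* [B] takes over the role of [A] for ranks below [n]. *)
have [||F CF Fn|h [Bh Ch]] := IH [set h | through h B].
- exact: through_ex.
- move=> k kn h /= Bh; apply/through_mul => //; apply: fstab_x.
  by rewrite rB neq_ltn kn.
- case: (chC F B CF CB) => /face_leP[_ [h [h1 h2]]]; by exists h.
have [|h' [Ah' Bh']] := AC B CB; first by rewrite rB.
(* [h'] lies in [A] and [B], while [h] lies in [B] and all lower faces. The part [u] uses generators
   below, which preserve [A]; [v] uses those above, which preserve [B] and the lower faces. So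
   [v h = u^-1 h'] serves all of them. *)
have [|u [v [Uu Vv uv]]] := @fstab_decomp n (h' * h^-1).
  by rewrite -rB; apply/through_fstab.
have vh : v * h = u^-1 * h' by rewrite -[h'](mulgVK h) uv -!mulgA mulKg.
exists (v * h); split.
  rewrite vh; have {Uu} := subgroupV (par_subgroup _ _ _ _ _) Uu.
  move: (u^-1) => w Uw; elim/par_indl: w / Uw => [|w k _ kn IHw]; first by rewrite mul1g.
  by rewrite -mulgA; apply: A_stab => //; apply: ltnW.
move=> F CF; rewrite ltnS leq_eqVlt => /orP[/eqP rF|Fn].
  have -> : F = B.
    have rFB : frank F = frank B by rewrite rF.
    case: (chC F B CF CB) => /face_leP[_ [k [k1 k2]]]; first exact: face_eq k1 k2.
    exact: face_eq k2 k1.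
  apply/through_mul => //; rewrite rB; apply: fstab_par Vv => k /= nk.
  by rewrite neq_ltn nk orbT.
apply/through_mul; last exact: Ch.
by apply: fstab_par Vv => k /= nk; rewrite neq_ltn (ltn_trans Fn nk) orbT.
Qed.

(** * Flags as sets of faces through a group element *)

Definition flag_at g : set face := [set face_at n g | n in `I_7].

Lemma flag_at_through g F : flag_at g F <-> through g F.
Proof.
split=> [[n _ <-]|Fg]; first exact: through_face_at.
by exists (frank F); [rewrite /= ltnS frank_le6|rewrite -face_atE].
Qed.

Lemma flag_at_chain g : chain (flag_at g).
Proof.
move=> F H /flag_at_through Fg /flag_at_through Hg.
by case: (leqP (frank F) (frank H)) => [|/ltnW] FH; [left|right];
  [apply: face_le Fg Hg FH|apply: face_le Hg Fg FH].
Qed.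

Lemma flag_at_flag g : flag (flag_at g).
Proof.
split; first exact: flag_at_chain.
move=> D chD gD; apply/seteqP; split=> // F DF; apply/flag_at_through.
(* [D] also holds the face of [flag_at g] with the rank of [F]; comparable faces of equal rank
   coincide. *)
have gF : D (face_at (frank F) g) by apply/gD/flag_at_through/through_face_at.
have rF := frank_face_at g (frank_le6 F).
have -> : F = face_at (frank F) g; last exact: through_face_at.
case: (chD _ _ DF gF) => /face_leP[_ [h [h1 h2]]]; first exact: face_eq h1 h2.
exact: face_eq h2 h1.
Qed.

Lemma flagP C : flag C -> exists g, C = flag_at g.
Proof.
case=> chC maxC; have [g Cg] := chain_through chC; exists g.
apply/esym/maxC; first exact: flag_at_chain.
by move=> F /Cg /flag_at_through.
Qed.

Lemma card_flag_at C : flag C -> (C #= `I_7)%card.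
Proof.
move=> /flagP[g ->]; apply: inj_card_eq => n m.
rewrite !inE /= !ltnS => n6 m6 /(congr1 frank).
by rewrite !frank_face_at.
Qed.

End Faces.

Arguments face_at : simpl never.

(** * Polytopality and regularity from the intersection property *)

Section PolytopeFromIntersection.
Variables p1 p2 p3 p4 : nat.
Local Open Scope order_scope.
Local Open Scope group_scope.
Local Notation Gamma := (Gamma p1 p2 p3 p4).
Local Notation x := (xgen p1 p2 p3 p4).
Local Notation par := (@par p1 p2 p3 p4).
Local Notation face := (Gamma_poset p1 p2 p3 p4).
Local Notation face_at := (@face_at p1 p2 p3 p4).
Implicit Types (F H K : face) (g h : Gamma) (n m : nat) (C D : set face).

Hypothesis bigcap_par : forall (J : set 'I_5) g,
  (forall k, ~ J k -> Gamma_sub k g) -> par J g.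
Variable sign : Gamma -> bool.
Hypothesis signM : forall g h, sign (g * h) = sign g (+) sign h.
Hypothesis sign_x : forall j, (j < 5)%N -> sign (x j) = true.

Lemma sign1 : sign 1 = false.
Proof. by have := signM 1 1; rewrite mulg1; case: (sign 1). Qed.

Lemma signX g n : sign g = false -> sign (g ^+ n) = false.
Proof. by move=> sg; elim: n => [|n IH]; rewrite ?expg0 ?sign1 // expgS signM sg. Qed.

Lemma par_set0 g : par set0 g -> g = 1.
Proof. by move=> g0; elim/par_indr: g / g0 => // g j _ []. Qed.

Lemma par_single j g : (j < 5)%N -> par [set k : 'I_5 | k = j :> nat] g -> g = 1 \/ g = x j.
Proof.
move=> j5 gj; elim/par_indl: g / gj => [|g k _ /= -> [->|->]]; first by left.
  by right; rewrite mulg1.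
by left; apply: x_invol.
Qed.

(** Otherwise [x j] would lie in every maximal parabolic, hence be 1 by the intersection property,
    against its sign. *)
Lemma Gamma_sub_gen (j : 'I_5) : ~ Gamma_sub j (x j).
Proof.
move=> xj; suff x1 : x j = 1 by have := sign_x (ltn_ord j); rewrite x1 sign1.
apply: par_set0; apply: bigcap_par => k _; have [->//|jk] := eqVneq k j.
by apply: par_gen; rewrite /= eq_sym.
Qed.

Lemma fstab_gen (j : 'I_5) n : fstab n (x j) -> j.+1 != n.
Proof.
move=> xj; apply/eqP => jn; apply: (@Gamma_sub_gen j).
by move: xj; rewrite -jn.
Qed.

(** [g h^-1] fixes a face of every rank, so it lies in all maximal parabolics and is trivial. *)
Lemma flag_at_inj g h : flag_at g `<=` flag_at h -> g = h.
Proof.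
move=> gh; apply/eqP; rewrite -divg_eq1; apply/eqP; apply: par_set0; apply: bigcap_par => k _.
have hk : through h (face_at k.+1 g).
  by apply/flag_at_through; apply: gh; apply/flag_at_through; apply: through_face_at.
have := through_face_at k.+1 g; move/(through_fstab _ hk).
by rewrite frank_face_at; [apply|exact: ltnW (ltn_ord k)].
Qed.

(** * Sections as coset geometries of parabolic subgroups *)

Definition between n m : set 'I_5 := [set k : 'I_5 | (n < k.+1 < m)%N].

(** With shifted ranks [x k] can move only faces of rank [k.+1], so these generators fix all faces
    outside the open interval. *)
Lemma fstab_between n m l : (l <= n)%N || (m <= l)%N -> par (between n m) `<=` fstab l.
Proof.
move=> lnm; apply: fstab_par => k /= /andP[nk km].
case/orP: lnm => [ln|ml]; first by rewrite neq_ltn (leq_ltn_trans ln) ?orbT.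
by rewrite neq_ltn (leq_trans km).
Qed.

Lemma face_at_fstab l s g : (l <= 6)%N -> fstab l s -> face_at l (s * g) = face_at l g.
Proof.
move=> l6 ls; apply: (@face_eq _ _ _ _ _ _ g); rewrite ?frank_face_at //.
  have := through_face_at l (s * g); rewrite through_mul //.
  by rewrite frank_face_at.
exact: through_face_at.
Qed.

(** A common element [z] of the enlarged chain has [z g^-1] in every maximal parabolic indexed
    outside the open interval; the intersection property confines it to [par (between n m)]. *)
Lemma section_through n m g C : (n <= m <= 6)%N -> chain C ->
    (forall F, C F -> face_at n g <= F <= face_at m g) ->
  exists s, par (between n m) s /\ forall F, C F -> through (s * g) F.
Proof.
move=> /andP[nm m6] chC CF.
(* The faces of [flag_at g] outside the open interval; added to [C] they still form a chain. *)
pose B := [set F | exists l, [/\ (l <= 6)%N, (l <= n)%N || (m <= l)%N & F = face_at l g]].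
have CB F H : C F -> B H -> F <= H \/ H <= F.
  move=> /CF/andP[nF Fm] [l [l6 /orP[ln|ml] ->]]; [right|left].
    by apply: le_trans nF; apply: face_at_le; rewrite ln (leq_trans nm).
  by apply: le_trans Fm _; apply: face_at_le; rewrite ml.
have [|z zB] := @chain_through _ _ _ _ (C `|` B).
  move=> F H [CF'|BF] [CH|BH]; [exact: chC|exact: CB|by case: (CB H F CH BF); [right|left]|].
  by apply: (@flag_at_chain _ _ _ _ g); apply/flag_at_through;
    [case: BF|case: BH] => l [_ _ ->]; apply: through_face_at.
exists (z * g^-1); split; last by move=> F CF'; rewrite mulgVK; apply: zB; left.
apply: bigcap_par => k /= nk.
have /zB : (C `|` B) (face_at k.+1 g).
  right; exists k.+1; split; rewrite ?ltnS ?ltn_ord //; first exact: ltnW.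
  by move/negP: nk; rewrite negb_and -!leqNgt.
move/(through_fstab _ (through_face_at k.+1 g)).
by rewrite frank_face_at; [apply|exact: ltnW (ltn_ord k)].
Qed.

Lemma x_between n m j : (j < 5)%N -> (n < j.+1 < m)%N -> par (between n m) (x j).
Proof. by move=> j5 nj; apply: (@par_gen _ _ _ _ _ (Ordinal j5)). Qed.

Lemma fstab_x_nat n j : (j < 5)%N -> j.+1 != n -> fstab n (x j).
Proof. by move=> j5; apply: (@fstab_x _ _ _ _ _ (Ordinal j5)). Qed.

Lemma chain2 F H : F <= H -> chain [set F; H].
Proof. by move=> FH A B [->|->] [->|->]; [left|left|right|left]. Qed.

Lemma ltface_at F H : F < H ->
  exists g, [/\ F = face_at (frank F) g, H = face_at (frank H) g,
                through g F & through g H].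
Proof.
move=> /ltW /chain2 /chain_through[g gFH]; exists g.
have Fg : through g F by apply: gFH; left.
have Hg : through g H by apply: gFH; right.
by split=> //; apply: face_atE.
Qed.

Lemma proper_sectionP n m g H : (n < m <= 6)%N ->
  proper_section (face_at n g) (face_at m g) H <->
  (n < frank H < m)%N /\
  exists s, par (between n m) s /\ H = face_at (frank H) (s * g).
Proof.
move=> /andP[nm m6]; have n6 : (n <= 6)%N by apply: ltnW (leq_trans nm m6).
split=> [/andP[nH Hm]|[/andP[nH Hm] [s [ns eH]]]].
  split.
    by have := face_lt_rank nH; have := face_lt_rank Hm; rewrite !frank_face_at // => -> ->.
  have [||F ->|s [ns Cs]] := @section_through n m g [set H].
  - by rewrite (ltnW nm).
  - by move=> ? ? -> ->; left.
  - by rewrite !ltW.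
  by exists s; split=> //; apply/face_atE/Cs.
rewrite /proper_section /= eH -(@face_at_fstab n s) //; last first.
  by apply: fstab_between ns; rewrite leqnn.
rewrite -(@face_at_fstab m s) //; last by apply: fstab_between ns; rewrite leqnn orbT.
by rewrite !face_at_lt // ?nH ?Hm // (leq_trans (ltnW Hm)).
Qed.

(** * Connectedness of sections *)

Section Connectivity.
Variables (X Y : face).

Let linked F H := exists s : seq face,
  [/\ path (fun A B => A >=< B) F s, last F s = H & forall A, A \in s -> proper_section X Y A].

Lemma linked_trans F H K : linked F H -> linked H K -> linked F K.
Proof.
move=> [s [ps ls sX]] [t [pt lt tX]]; exists (s ++ t).
rewrite cat_path last_cat ls ps pt lt; split=> // A.
by rewrite mem_cat => /orP[/sX|/tX].
Qed.

Lemma linked1 F H : F >=< H -> proper_section X Y H -> linked F H.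
Proof.
by move=> FH XH; exists [:: H]; rewrite /= FH; split=> // A; rewrite inE => /eqP ->.
Qed.

Lemma section_connected : X < Y -> (frank X + 3 <= frank Y)%N -> connected_section X Y.
Proof.
move=> XY XY3 F H XF XH.
have [g gC] : exists g, forall Z, [set X; F; Y] Z -> through g Z.
  apply: chain_through; case/andP: XF => /ltW XF /ltW FY; have XY' := ltW XY.
  by move=> A B [[->|->]|->] [[->|->]|->]; (by left) || (by right).
have eX : X = face_at (frank X) g by apply/face_atE/gC; left; left.
have eF : F = face_at (frank F) g by apply/face_atE/gC; left; right.
have eY : Y = face_at (frank Y) g by apply/face_atE/gC; right.
have Y6 := frank_le6 Y.
set n := frank X in eX XY3; set m := frank Y in eY XY3 Y6.
have nm : (n < m <= 6)%N by rewrite Y6 andbT; lia.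
have sec l s : (n < l < m)%N -> par (between n m) s ->
    proper_section X Y (face_at l (s * g)).
  move=> nlm ns; rewrite eX eY; apply/proper_sectionP => //.
  have l6 : (l <= 6)%N by case/andP: nlm => _ lm; apply: leq_trans (ltnW lm) Y6.
  by rewrite frank_face_at //; split=> //; exists s.
have step l l' s : (n < l < m)%N -> (n < l' < m)%N -> par (between n m) s ->
    linked (face_at l (s * g)) (face_at l' (s * g)).
  move=> nl nl' ns; apply: linked1; last exact: sec.
  have [_ l6] : (n < l)%N /\ (l <= 6)%N by case/andP: nl => nl /ltnW/leq_trans->.
  have [_ l6'] : (n < l')%N /\ (l' <= 6)%N by case/andP: nl' => nl' /ltnW/leq_trans->.
  case: (leqP l l') => [|/ltnW] ll'; first by rewrite /Order.comparable face_at_le ?ll'.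
  by rewrite /Order.comparable [X in _ || X]face_at_le ?ll' ?orbT.
have nF : (n < frank F < m)%N by case/andP: XF => /face_lt_rank -> /face_lt_rank ->.
suff link s : par (between n m) s -> forall l, (n < l < m)%N ->
    linked F (face_at l (s * g)).
  move: XH; rewrite {1}eX {1}eY => /(proper_sectionP _ _ nm)[nH [s [ns ->]]].
  exact: link.
move=> ns; elim/par_indl: s / ns => [l nl|s k ns nk IH l nl].
  rewrite eF -{1}[g]mul1g; apply: step => //.
  exact: (subgroup1 (par_subgroup _ _ _ _ _)).
(* The rank gap leaves room for both [n.+1] and [n.+2]. One of them differs from [k.+1], and [x k]
   fixes the face of that rank, which links the old flag to the new one. *)
have [l' nl' kl'] : exists2 l', (n < l' < m)%N & k.+1 != l'.
  have [kn|kn] := eqVneq k.+1 n.+1; [exists n.+2|exists n.+1] => //;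
    by rewrite ?kn; lia.
apply: linked_trans (IH l' nl') _; rewrite -(@face_at_fstab l' (x k)).
- rewrite mulgA; apply: step => //.
  by apply: (subgroupM (par_subgroup _ _ _ _ _)) => //; apply: par_gen.
- by case/andP: nl' => _ /ltnW/leq_trans->.
- exact: fstab_x.
Qed.

End Connectivity.

(** * The diamond condition, polytopality and tightness *)

Lemma section_diamond n g H : (n <= 4)%N ->
  proper_section (face_at n g) (face_at n.+2 g) H <->
  H = face_at n.+1 g \/ H = face_at n.+1 (x n * g).
Proof.
move=> n4; have n6 : (n < n.+2 <= 6)%N by lia.
have n15 : (n < 5)%N by [].
have betw : between n n.+2 = [set k : 'I_5 | k = n :> nat].
  by apply/seteqP; split=> k; rewrite /between /=; lia.
rewrite proper_sectionP // betw; split=> [[/andP[nH Hn] [s [ns ->]]]|].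
  have -> : frank H = n.+1 by apply/eqP; rewrite eqn_leq nH andbT -ltnS.
  by have [->|->] := par_single n15 ns; [left; rewrite mul1g|right].
have n1 : (n < n.+1 < n.+2)%N by rewrite !ltnSn.
have n16 : (n.+1 <= 6)%N by apply: leqW.
by case=> ->; rewrite frank_face_at //; split=> //;
  [exists 1; split; [exact: (subgroup1 (par_subgroup _ _ _ _ _))|rewrite mul1g]
  |exists (x n); split=> //; apply: (@par_gen _ _ _ _ _ (Ordinal n15))].
Qed.

Lemma face_at_gen_neq n g : (n < 5)%N -> face_at n.+1 (x n * g) <> face_at n.+1 g.
Proof.
move=> n5 E; have := through_face_at n.+1 (x n * g).
rewrite E => /(through_fstab _ (through_face_at n.+1 g)).
rewrite mulgK frank_face_at; last exact: leqW.
by move=> /(@fstab_gen (Ordinal n5)); rewrite eqxx.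
Qed.

Lemma Gamma_is_polytope : is_polytope 5 (@Gamma_rank p1 p2 p3 p4).
Proof.
split=> //.
- by move=> F H /face_lt_rank FH; rewrite !frankE; lia.
- exact: card_flag_at.
- move=> F H FH; rewrite !frankE => rFH; apply: section_connected => //; lia.
- move=> F H FH; rewrite !frankE => rFH.
  have {}rFH : frank H = (frank F).+2 by lia.
  have [g [eF eH _ _]] := ltface_at FH.
  have H6 := frank_le6 H; rewrite rFH in H6 eH.
  move: (frank F) eF eH H6 => n -> -> H6 {F H FH rFH}.
  pose f i := face_at n.+1 (x n ^+ i * g).
  have -> : proper_section (face_at n g) (face_at n.+2 g) = f @` `I_2.
    apply/seteqP; split=> H.
      move/(section_diamond _ _ H6) => [->|->]; [exists 0%N|exists 1%N] => //.
        by rewrite /f expg0 mul1g.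
    case=> -[|[|//]] _ <-; apply/(section_diamond _ _ H6); rewrite /f.
      by left; rewrite expg0 mul1g.
    by right; rewrite expg1.
  have f01 : f 1%N <> f 0%N by rewrite /f expg0 expg1 mul1g; apply: face_at_gen_neq.
  apply: inj_card_eq => -[|[|i]] [|[|j]]; rewrite ?inE //=; by move=> _ _ /esym/f01.
Qed.

Lemma Gamma_tight : ([set: Gamma] #= `I_(2 * (p1 * p2 * p3 * p4))%N)%card ->
  tight face [:: p1; p2; p3; p4].
Proof.
move=> cardG; rewrite /tight !big_cons big_nil muln1 !mulnA -!(mulnA 2) !mulnA.
have -> : [set C : set face | flag C] = @flag_at p1 p2 p3 p4 @` [set: Gamma].
  apply/seteqP; split=> [C /flagP[g ->]|_ [g _ <-]]; first by exists g.
  exact: flag_at_flag.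
rewrite -!mulnA !mulnA -!(mulnA 2) in cardG *.
apply: card_eq_trans cardG; apply: inj_card_eq => g h _ _ gh.
by apply: flag_at_inj; rewrite gh.
Qed.

(** * Sections of rank two as polygons of a dihedral group *)

Section Polygon.
Variables (n p : nat) (g : Gamma).
Hypotheses (n4 : (n < 4)%N) (p_gt0 : (0 < p)%N).
Hypothesis order_p : forall i, (x n * x n.+1) ^+ i = 1 <-> (p %| i)%N.

Let s := x n.
Let r := x n.+1.
(** One step along the cycle: left multiplication by [r] leaves vertices unchanged and by [s] edges,
    so the vertex at [y^(i+1) g] is the one at [s y^i g], which lies on the edge at [y^i g]. *)
Let y := r * s.

Let ss : s * s = 1. Proof. exact: x_invol. Qed.
Let rr : r * r = 1. Proof. exact: x_invol. Qed.

Let y_eq1 i : y ^+ i = 1 <-> (p %| i)%N.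
Proof.
rewrite -order_p; have -> : y = (s * r)^-1 by rewrite invgM (invol_inv ss) (invol_inv rr).
by rewrite expVgn; split=> [/eqP|->]; rewrite ?invg1 // invg_eq1 => /eqP.
Qed.

Let y_mod i : y ^+ (i %% p) = y ^+ i.
Proof. by apply: expgn_mod; apply/y_eq1. Qed.

Let y_inj (i j : nat) : y ^+ i = y ^+ j -> i = j %[mod p].
Proof.
wlog ij : i j / (i <= j)%N.
  by move=> W; case: (leqP i j) => [/W//|/ltnW/W{}W /esym/W].
move=> yij; apply/esym/eqP; rewrite eqn_mod_dvd //; apply/y_eq1.
by rewrite expgnFr // yij mulgV.
Qed.

Let sign_y i : sign (y ^+ i) = false.
Proof. by apply: signX; rewrite signM !sign_x // ltnW. Qed.

Local Notation mid := (par (between n n.+3)).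

Let mid_s : mid s.
Proof. by apply: x_between; lia. Qed.

Let mid_r : mid r.
Proof. by apply: x_between; lia. Qed.

Let mid_y i : mid (y ^+ i).
Proof.
apply: (subgroupX (par_subgroup _ _ _ _ _)).
exact: (subgroupM (par_subgroup _ _ _ _ _)).
Qed.

Let y_pred i : s * (r * y ^+ i) = y ^+ (i + p.-1).
Proof.
have yp : y ^+ p = 1 by apply/y_eq1.
apply: (mulgI y); rewrite -expgS -addnS prednK // expgnDr yp mulg1.
by rewrite {1}/y !mulgA -(mulgA r) ss mulg1 rr mul1g.
Qed.

(** The generators involved are just [s] and [r], so this is the dihedral normal form. *)
Let mid_normal (m : Gamma) : mid m -> exists i, m = y ^+ i \/ m = r * y ^+ i.
Proof.
move=> mm; elim/par_indl: m / mm => [|m k _ nk [i mi]]; first by exists 0%N; left; rewrite expg0.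
have [->|->] : x k = s \/ x k = r.
  by have [->|->] : k = n :> nat \/ k = n.+1 :> nat;
    [move: nk; rewrite /between /=; lia|left|right].
  case: mi => ->; last by exists (i + p.-1)%N; left; apply: y_pred.
  by exists i.+1; right; rewrite expgS /y !mulgA rr mul1g.
by case: mi => ->; exists i; [right|left]; rewrite ?mulgA ?rr ?mul1g.
Qed.

Let stab_v : fstab n.+1 r.
Proof. by apply: fstab_x_nat; lia. Qed.

Let stab_e : fstab n.+2 s.
Proof. by apply: fstab_x_nat; lia. Qed.

Let mid_v (m : Gamma) : mid m -> fstab n.+1 m -> m = 1 \/ m = r.
Proof.
move=> mm vm; apply: (@par_single n.+1) => //; apply: bigcap_par => k /= nk.
have [kn|kn] := eqVneq k.+1 n.+1; first by move: vm; rewrite -kn.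
have : fstab k.+1 m by apply: fstab_between mm; lia.
exact.
Qed.

Let mid_e (m : Gamma) : mid m -> fstab n.+2 m -> m = 1 \/ m = s.
Proof.
move=> mm vm; apply: (@par_single n); first exact: ltnW.
apply: bigcap_par => k /= nk.
have [kn|kn] := eqVneq k.+1 n.+2; first by move: vm; rewrite -kn.
have : fstab k.+1 m by apply: fstab_between mm; lia.
exact.
Qed.

Let v (i : 'I_p) := face_at n.+1 (y ^+ i * g).
Let e (i : 'I_p) := face_at n.+2 (y ^+ i * g).

Let n16 : (n.+1 <= 6)%N. Proof. by lia. Qed.
Let n26 : (n.+2 <= 6)%N. Proof. by lia. Qed.
Let n36 : (n < n.+3 <= 6)%N. Proof. by lia. Qed.

Let stab_quotient l i j :
  (l <= 6)%N -> face_at l (y ^+ i * g) = face_at l (y ^+ j * g) -> fstab l (y ^+ i * (y ^+ j)^-1).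
Proof.
move=> l6 E; have := through_face_at l (y ^+ i * g).
rewrite E => /(through_fstab _ (through_face_at l (y ^+ j * g))).
by rewrite frank_face_at // invgM !mulgA mulgK.
Qed.

Let mid_quotient i j : mid (y ^+ i * (y ^+ j)^-1).
Proof.
apply: (subgroupM (par_subgroup _ _ _ _ _)) => //.
exact: (subgroupV (par_subgroup _ _ _ _ _)).
Qed.

Let sign_quotient i j : sign (y ^+ i * (y ^+ j)^-1) = false.
Proof.
have : sign (y ^+ i * (y ^+ j)^-1 * y ^+ j) = false by rewrite mulgVK sign_y.
by rewrite signM sign_y addbF.
Qed.

Let ord_y_inj (i j : 'I_p) : y ^+ i * (y ^+ j)^-1 = 1 -> i = j.
Proof. by move/divg1_eq/y_inj; rewrite !modn_small // => /val_inj. Qed.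

Lemma Gamma_polygon : polygon_section (@Gamma_rank p1 p2 p3 p4) p
  (face_at n g) (face_at n.+3 g).
Proof.
exists v, e; split.
(* The quotient fixes a vertex, so it is 1 or [r]; the sign excludes [r], as powers of [y] are
   even. *)
- move=> i j /(stab_quotient n16) /(mid_v (mid_quotient _ _))[/ord_y_inj//|E].
  by have := sign_quotient i j; rewrite E sign_x.
- move=> i j /(stab_quotient n26) /(mid_e (mid_quotient _ _))[/ord_y_inj//|E].
  by have := sign_quotient i j; rewrite E sign_x // ltnW.
- apply/seteqP; split=> [_ [i _ <-]|H [/(proper_sectionP _ _ n36)[nH [m [mm eH]]]]].
    split; first by apply/proper_sectionP => //; rewrite frank_face_at //;
      split; [lia|exists (y ^+ i)].
    by rewrite !frankE !frank_face_at //; lia.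
  rewrite !frankE frank_face_at; last lia.
  move=> rH; have {}rH : frank H = n.+1 by lia.
  rewrite eH rH; have [i mi] := mid_normal mm.
  exists (Ordinal (ltn_pmod i p_gt0)) => //; rewrite /v /= y_mod.
  by case: mi => -> //; rewrite -[r * _ * g]mulgA [RHS]face_at_fstab.
- apply/seteqP; split=> [_ [i _ <-]|H [/(proper_sectionP _ _ n36)[nH [m [mm eH]]]]].
    split; first by apply/proper_sectionP => //; rewrite frank_face_at //;
      split; [lia|exists (y ^+ i)].
    by rewrite !frankE !frank_face_at //; lia.
  rewrite !frankE frank_face_at; last lia.
  move=> rH; have {}rH : frank H = n.+2 by lia.
  rewrite eH rH; have [i [->|mi]] := mid_normal mm.
    by exists (Ordinal (ltn_pmod i p_gt0)) => //; rewrite /e /= y_mod.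
  (* Multiplying [r y^i] by [s] on the left keeps the edge and gives [y^(i-1)], written with [p.-1]
     to avoid subtraction. *)
  exists (Ordinal (ltn_pmod (i + p.-1) p_gt0)) => //; rewrite /e /= y_mod.
  by rewrite -y_pred -mi -mulgA; apply: face_at_fstab.
- move=> i j; apply/idP/idP => [vij|].
    have [||F|m [mm Cm]] := @section_through n n.+3 g [set v i; e j].
    - by lia.
    - exact: chain2.
    - have vi : face_at n g <= v i <= face_at n.+3 g.
        rewrite /v -(@face_at_fstab n (y ^+ i)) //; [|lia|by apply: fstab_between (mid_y i); lia].
        rewrite -(@face_at_fstab n.+3 (y ^+ i)) //; [|by apply: fstab_between (mid_y i); lia].
        by rewrite !face_at_le //; lia.
      have ej : face_at n g <= e j <= face_at n.+3 g.
        rewrite /e -(@face_at_fstab n (y ^+ j)) //; [|lia|by apply: fstab_between (mid_y j); lia].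
        rewrite -(@face_at_fstab n.+3 (y ^+ j)) //; [|by apply: fstab_between (mid_y j); lia].
        by rewrite !face_at_le //; lia.
      by case=> ->.
    have quot l k : (l <= 6)%N -> through (m * g) (face_at l (y ^+ k * g)) ->
        fstab l (m * (y ^+ k)^-1).
      move=> l6 /(through_fstab _ (through_face_at l (y ^+ k * g))).
      by rewrite frank_face_at // invgM !mulgA mulgK.
    have midq k : mid (m * (y ^+ k)^-1).
      apply: (subgroupM (par_subgroup _ _ _ _ _)) => //.
      exact: (subgroupV (par_subgroup _ _ _ _ _)).
    have mv : m = y ^+ i \/ m = r * y ^+ i.
      have /(quot _ _ n16) /(mid_v (midq i)) : through (m * g) (v i) by apply: Cm; left.
      by case=> /eqP; [rewrite divg_eq1|rewrite divg_eq] => /eqP; [left|right].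
    have me : m = y ^+ j \/ m = s * y ^+ j.
      have /(quot _ _ n26) /(mid_e (midq j)) : through (m * g) (e j) by apply: Cm; right.
      by case=> /eqP; [rewrite divg_eq1|rewrite divg_eq] => /eqP; [left|right].
    have sr : sign r = true by apply: sign_x.
    have s_s : sign s = true by apply/sign_x/ltnW.
    (* The sign excludes the mixed cases: either [y^i = y^j], or [r y^i = s y^j], that is
       [y^i = y^(j+1)]. *)
    case: mv => mi; case: me => mj; move: (congr1 sign mj);
      rewrite {1}mi ?signM !sign_y ?sr ?s_s //= => _.
      by apply/orP; left; apply/eqP/ord_y_inj; rewrite -mi mj mulgV.
    apply/orP; right; apply/eqP/val_inj => /=.
    have : y ^+ i = y ^+ j.+1 by rewrite expgS -mulgA -mj mi mulgA rr mul1g.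
    by move/y_inj; rewrite modn_small.
  case/orP=> /eqP ->.
    by apply: face_at_le; lia.
  have -> : v (ordS j) = face_at n.+1 (s * y ^+ j * g).
    rewrite /v /= y_mod expgS {1}/y -!mulgA face_at_fstab //.
  have -> : e j = face_at n.+2 (s * y ^+ j * g) by rewrite -mulgA face_at_fstab.
  by apply: face_at_le; lia.
Qed.

End Polygon.

Lemma Gamma_has_type :
    (forall j, (0 < j < 5)%N -> (0 < nth 0 [:: p1; p2; p3; p4] j.-1)%N) ->
    (forall j i, (0 < j < 5)%N ->
      (x j.-1 * x j) ^+ i = 1 <-> (nth 0 [:: p1; p2; p3; p4] j.-1 %| i)%N) ->
  has_type (@Gamma_rank p1 p2 p3 p4) [:: p1; p2; p3; p4].
Proof.
move=> p_gt0 x_order j j14 F H; rewrite !frankE => rF rH FH.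
have {}j14 : (0 < j < 5)%N by [].
have [g [-> -> _ _]] := ltface_at FH.
have -> : frank F = j.-1 by lia.
have -> : frank H = j.-1.+3 by lia.
apply: Gamma_polygon; [lia|exact: p_gt0|move=> i].
by rewrite prednK ?x_order //; lia.
Qed.

(** * Right translations as automorphisms, and flag-transitivity *)

Lemma coset_translate (j : 'I_5) g (A : set Gamma) :
  Gamma_coset j A -> Gamma_coset j [set h | A (h * g^-1)].
Proof.
move=> [k eA]; exists (k * g); apply/seteqP.
by split=> h /=; rewrite eA => /rcosetP Hh; apply/rcosetP; move: Hh; rewrite invgM !mulgA.
Qed.

Definition translate g F : face :=
  match F with
  | LeastFace => LeastFace p1 p2 p3 p4
  | CosetFace j A cA => CosetFace (coset_translate g cA)
  | GreatestFace => GreatestFace p1 p2 p3 p4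
  end.

Lemma frank_translate g F : frank (translate g F) = frank F.
Proof. by case: F. Qed.

Lemma through_translate g h F : through h (translate g F) <-> through (h * g^-1) F.
Proof. by case: F. Qed.

Lemma translate_through g h F : through h F -> through (h * g) (translate g F).
Proof. by move=> Fh; apply/through_translate; rewrite mulgK. Qed.

Lemma translateM g h F : translate h (translate g F) = translate (g * h) F.
Proof.
have [k Fk] := through_ex F.
apply: (@face_eq _ _ _ _ _ _ (k * (g * h))); rewrite ?frank_translate //.
  by rewrite mulgA; do 2!apply: translate_through.
exact: translate_through.
Qed.

Lemma translate1 F : translate 1 F = F.
Proof.
have [k Fk] := through_ex F.
apply: (@face_eq _ _ _ _ _ _ k); rewrite ?frank_translate //.
by apply/through_translate; rewrite invg1 mulg1.
Qed.

Lemma translateK g : cancel (translate g) (translate g^-1).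
Proof. by move=> F; rewrite translateM mulgV translate1. Qed.

Lemma translateVK g : cancel (translate g^-1) (translate g).
Proof. by move=> F; rewrite translateM mulVg translate1. Qed.

Lemma translate_mono g : {mono translate g : F H / F <= H}.
Proof.
have le_translate h F H : F <= H -> translate h F <= translate h H.
  move=> /face_leP[rFH [k [Fk Hk]]]; apply/face_leP; rewrite !frank_translate.
  by split=> //; exists (k * h); split; apply: translate_through.
move=> F H; apply/idP/idP; last exact: le_translate.
by move=> /(le_translate g^-1); rewrite !translateK.
Qed.

Definition translation g : automorphism face :=
  Automorphism (translateK g) (translateVK g) (translate_mono g).

Lemma translationM g h : translation (g * h) = translation g * translation h.
Proof. by apply: aut_ext => F; rewrite /= translateM. Qed.

Lemma translation1 : translation 1 = 1.
Proof. by apply: aut_ext => F; rewrite /= translate1. Qed.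

Lemma translate_face_at n g h : (n <= 6)%N -> translate g (face_at n h) = face_at n (h * g).
Proof.
move=> n6; apply: (@face_eq _ _ _ _ _ _ (h * g)).
- by rewrite frank_translate !frank_face_at.
- by apply: translate_through; apply: through_face_at.
- exact: through_face_at.
Qed.

Lemma translate_flag_at g h : translation g @` flag_at h = flag_at (h * g).
Proof.
apply/seteqP; split=> [_ [_ [n n6 <-] <-]|_ [n n6 <-]].
  by exists n; rewrite //= translate_face_at.
by exists (face_at n h); [exists n|rewrite /= translate_face_at].
Qed.

Lemma translation_inj : injective translation.
Proof.
move=> g h gh; apply: flag_at_inj.
by rewrite -[g]mul1g -[h]mul1g -!translate_flag_at gh.
Qed.

Lemma Gamma_flag_transitive : @flag_transitive _ face.
Proof.
move=> _ _ /flagP[g ->] /flagP[h ->]; exists (translation (g^-1 * h)).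
by rewrite translate_flag_at mulVKg.
Qed.

(** * Rigidity: every automorphism is a translation *)

Lemma aut_lt (f : automorphism face) F H : (f F < f H) = (F < H).
Proof. by rewrite !lt_neqAle aut_mono (can_eq (aut_funK f)). Qed.

(** [f] maps a strictly increasing chain of faces up to [F] to another one, so ranks cannot drop. *)
Lemma frank_aut_le (f : automorphism face) F : (frank F <= frank (f F))%N.
Proof.
have [g /face_atE ->] := through_ex F; have := frank_le6 F.
elim: (frank F) => [|n IH] n6; rewrite frank_face_at //.
have {}IH := IH (ltnW n6); rewrite frank_face_at ?(ltnW n6) // in IH.
by apply: leq_ltn_trans IH _; apply: face_lt_rank; rewrite aut_lt face_at_lt ?ltnSn.
Qed.

Lemma frank_aut (f : automorphism face) F : frank (f F) = frank F.
Proof.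
apply/eqP; rewrite eqn_leq frank_aut_le andbT.
by have := frank_aut_le f^-1 (f F); rewrite /= aut_funK.
Qed.

(* An automorphism agreeing with a translation on one flag agrees with it on all
   adjacent flags, by the diamond condition. *)
Lemma aut_rigid (f : automorphism face) g :
  (forall n, (n <= 6)%N -> f (face_at n 1) = face_at n g) -> f = translation g.
Proof.
move=> f1; suff fh h : forall n, (n <= 6)%N -> f (face_at n h) = face_at n (h * g).
  apply: aut_ext => F; have [h /face_atE ->] := through_ex F.
  by rewrite fh ?frank_le6 //= translate_face_at ?frank_le6.
have := par_setT h; elim/par_indl: h / => [n|h k _ _ IH n] n6.
  by rewrite mul1g f1.
have [nk|nk] := eqVneq k.+1 n; last first.
  have nx : fstab n (x k) := fstab_x nk.
  by rewrite (face_at_fstab h n6 nx) IH // -mulgA (face_at_fstab (h * g) n6 nx).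
rewrite -nk; have k5 := ltn_ord k; have k4 : (k <= 4)%N by [].
have : proper_section (face_at k (h * g)) (face_at k.+2 (h * g)) (f (face_at k.+1 (x k * h))).
  rewrite -!IH; [|lia|lia]; rewrite /proper_section /= !aut_lt.
  rewrite -(@face_at_fstab k (x k) h); [|lia|by apply: fstab_x; lia].
  rewrite -(@face_at_fstab k.+2 (x k) h); [|lia|by apply: fstab_x; lia].
  by rewrite !face_at_lt //; lia.
move=> /(section_diamond _ _ k4)[|->]; last by rewrite mulgA.
rewrite -IH; last lia.
move=> /(congr1 (aut_inv f)); rewrite !aut_funK => E.
by case: (face_at_gen_neq k5 E).
Qed.

(** The image of the base flag is a chain, so it passes through some [g]; since [f] preserves ranks,
    it agrees there with the translation by [g], and rigidity applies. *)
Lemma translation_surj (f : automorphism face) : exists g, f = translation g.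
Proof.
have [g fg] : exists g, forall F, (f @` flag_at 1) F -> through g F.
  apply: chain_through => _ _ [F F1 <-] [H H1 <-]; rewrite !aut_mono.
  exact: flag_at_chain F1 H1.
exists g; apply: aut_rigid => n n6.
have /fg : (f @` flag_at 1) (f (face_at n 1)).
  by exists (face_at n 1) => //; apply/flag_at_through/through_face_at.
by move/face_atE; rewrite frank_aut frank_face_at.
Qed.

Definition reflection (j : 'I_5) : automorphism face := translation (x j).

Lemma reflectionK j : reflection j * reflection j = 1.
Proof. by rewrite -translationM x_invol translation1. Qed.

Lemma reflection_base : base_reflections (@Gamma_rank p1 p2 p3 p4) (flag_at 1) reflection.
Proof.
move=> j _ [n /= n7 <-]; have n6 : (n <= 6)%N by [].
rewrite translate_face_at // mul1g frankE frank_face_at //.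
have -> : (n%:Z - 1 != j%:Z)%R = (j.+1 != n) by lia.
apply/eqP/idP => [E|jn]; last by rewrite -[x j]mulg1 (face_at_fstab 1 n6 (fstab_x jn)).
apply: fstab_gen; have := through_face_at n (x j).
rewrite E => /(through_fstab _ (through_face_at n 1)).
by rewrite invg1 mulg1 frank_face_at.
Qed.

Lemma reflection_generated : generated (range reflection) = setT.
Proof.
apply/seteqP; split=> // f _; have [g ->] := translation_surj f.
have sg := generated_subgroup (range reflection).
have := par_setT g; elim/par_indr: g / => [|g j _ _ IH].
  by rewrite translation1; apply: (subgroup1 sg).
by rewrite translationM; apply: (subgroupM sg) => //; apply: sub_generated; exists j.
Qed.

(** * The rotation subgroup and its index *)

Local Notation rotations := (rotation_subgroup reflection).

Lemma rotation_sign f : rotations f -> exists2 g, f = translation g & sign g = false.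
Proof.
apply: (@generated_ind _ _ [set f | exists2 g, f = translation g & sign g = false]).
  split=> [|_ _ [g -> sg] [h -> sh]|_ [g -> sg]] /=.
  - by exists 1; rewrite ?translation1 ?sign1.
  - by exists (g * h); rewrite ?translationM // signM sg sh.
  - exists g^-1; last by have := signM g g^-1; rewrite mulgV sign1 sg => ->.
    by apply/mulg1_eq; rewrite -translationM mulgV translation1.
move=> _ [i [j [_ ->]]]; exists (x i * x j); first by rewrite translationM.
by rewrite signM !sign_x.
Qed.

Lemma rotation_subgroupP : subgroup rotations.
Proof. exact: generated_subgroup. Qed.

(** Telescoping through the products of consecutive reflections. *)
Lemma rotation_mul0 (j : 'I_5) : rotations (reflection ord0 * reflection j).
Proof.
case: j => j; elim: j => [|j IH] j5.
  have -> : Ordinal j5 = ord0 by apply: val_inj.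
  by rewrite reflectionK; apply: (subgroup1 rotation_subgroupP).
have j5' : (j < 5)%N by apply: ltnW.
have -> : reflection ord0 * reflection (Ordinal j5) =
    (reflection ord0 * reflection (Ordinal j5')) *
    (reflection (Ordinal j5') * reflection (Ordinal j5)).
  by rewrite -mulgA (mulgA (reflection (Ordinal j5'))) reflectionK mul1g.
apply: (subgroupM rotation_subgroupP); first exact: IH.
by apply: sub_generated; exists (Ordinal j5'), (Ordinal j5).
Qed.

(** Even elements are rotations, and odd ones become so after one more reflection; hence there are
    at most two cosets. *)
Lemma rotation_coset g :
  rotations (translation g * (if sign g then reflection ord0 else 1)).
Proof.
have := par_setT g; elim/par_indr: g / => [|g j _ _ IH].
  by rewrite sign1 translation1 mulg1; apply: (subgroup1 rotation_subgroupP).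
rewrite translationM -/(reflection j) signM sign_x // addbT.
case: (sign g) IH => IH /=; rewrite ?mulg1 in IH *.
  rewrite -[translation g](mulgK (reflection ord0)) (mulg1_eq (reflectionK _)) -mulgA.
  exact: (subgroupM rotation_subgroupP) IH (rotation_mul0 _).
rewrite -mulgA; apply: (subgroupM rotation_subgroupP) IH _.
have := subgroupV rotation_subgroupP (rotation_mul0 j).
by rewrite invgM !(mulg1_eq (reflectionK _)).
Qed.

Lemma rotation_index : (range (rcoset rotations) #= `I_2)%card.
Proof.
pose c (i : nat) := rcoset rotations (reflection ord0 ^+ i).
have -> : range (rcoset rotations) = c @` `I_2.
  apply/seteqP; split=> [_ [f _ <-]|_ [i _ <-]]; last by exists (reflection ord0 ^+ i).
  have [g ->] := translation_surj f; have := rotation_coset g.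
  case: (sign g) => gr; [exists 1%N|exists 0%N] => //; rewrite /c;
    apply: rcoset_eq rotation_subgroupP _; apply/rcosetP.
    by rewrite expg1 (mulg1_eq (reflectionK _)).
  by rewrite expg0 invg1.
(* Equal cosets would make [reflection ord0] a rotation, hence even. *)
have c01 : c 0%N <> c 1%N.
  rewrite /c expg0 expg1 => E; have := rcoset_refl (reflection ord0) rotation_subgroupP.
  rewrite -E => /rcosetP; rewrite invg1 mulg1 => /rotation_sign[g /translation_inj <-].
  by rewrite sign_x.
apply: inj_card_eq => -[|[|i]] [|[|j]]; rewrite ?inE //=; by move=> _ _ /esym/c01.
Qed.

Lemma Gamma_orientably_regular : orientably_regular 5 (@Gamma_rank p1 p2 p3 p4).
Proof.
split; first exact: Gamma_flag_transitive.
exists (flag_at 1), reflection; split.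
- exact: flag_at_flag.
- exact: reflection_base.
- exact: reflection_generated.
- exact: rotation_index.
Qed.

End PolytopeFromIntersection.

Local Close Scope classical_set_scope.

Theorem theorem4p12 (p1 p2 p3 p4 : nat)
    (p1_gt1 : 1 < p1) (p4_gt1 : 1 < p4) (p1_odd : odd p1) (p4_odd : odd p4)
    (p2_even : ~~ odd p2) (p2_dvd : p2 %| 2 * p1)
    (p3_even : ~~ odd p3) (p3_dvd : p3 %| 2 * p4) :
  let P := Gamma_poset p1 p2 p3 p4 in
  let rk : P -> int := @Gamma_rank p1 p2 p3 p4 in
  [/\ is_polytope 5 rk,
      tight P [:: p1; p2; p3; p4],
      orientably_regular 5 rk
    & has_type rk [:: p1; p2; p3; p4]].
Proof.
(* Halves [p2] and [p3]: the results are the moduli of the exponents of [a] and [b], in successor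
   form for ['I_q2.+1] and ['I_q3.+1]. *)
have even_divisor p q : 0 < p -> ~~ odd q -> q %| 2 * p ->
    exists2 r, q = 2 * r.+1 & r.+1 %| p.
  move=> p_gt0 q_even q_dvd; have qE : q = 2 * q./2 by rewrite mul2n even_halfK.
  have q_gt0 : 0 < q./2.
    by rewrite -(ltn_pmul2l (isT : 0 < 2)) muln0 -qE (dvdn_gt0 _ q_dvd) ?muln_gt0.
  by exists q./2.-1; rewrite prednK // -(@dvdn_pmul2l 2) // -qE.
have [|q2 -> q2_dvd] := even_divisor p1 p2 _ p2_even p2_dvd; first exact: ltnW.
have [|q3 -> q3_dvd] := even_divisor p4 p3 _ p3_even p3_dvd; first exact: ltnW.
(* With [p1 = m1.+1] the bound [1 < p1] reads [0 < m1], which keeps [Zp1] distinct from 0 in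
   [half_nf_mem]. *)
case: p1 p1_gt1 q2_dvd {p1_odd p2_dvd} => // m1 m1_gt0 q2_dvd.
case: p4 p4_gt1 q3_dvd {p4_odd p3_dvd} => // m4 m4_gt0 q3_dvd P rk.
have cap J g := (par_bigcap m1_gt0 m4_gt0 q2_dvd q3_dvd J g).2.
have parM := parityM q2_dvd q3_dvd.
have par_x j : j < 5 -> parity (xgen m1.+1 (2 * q2.+1) (2 * q3.+1) m4.+1 j) = true.
  move=> j5; have := parity_mulx q2_dvd q3_dvd 1%g (Ordinal j5).
  by rewrite mul1g parity1.
split.
- exact: (Gamma_is_polytope cap parM par_x).
- exact: (Gamma_tight cap (Gamma_card m1_gt0 m4_gt0 q2_dvd q3_dvd)).
- exact: (Gamma_orientably_regular cap parM par_x).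
apply: (Gamma_has_type cap parM par_x) => [j|j i] j14.
  by case: j j14 => [|[|[|[|[|j]]]]].
split=> [|/dvdnP[k ->]]; first exact: xxX_order.
by rewrite (mulnC k) expgnA x_relation_pair // expg1n.
Qed.
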